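(* Let $p>0$ be a constant and let $G\sim G(n,p)$ be the Erdős–Rényi random graph on $n$ vertices (each of the $\binom n2$ possible edges present independently with probability $p$). Let $X$ be the number of common edges of two independent spanning trees of $G$, each chosen uniformly at random among the spanning trees of $G$, where $X$ is defined to be $0$ in the event that $G$ is disconnected. Then $X$ converges in distribution to a Poisson distribution with expected value $2/p$; that is, for every integer $m\ge 0$, $$\mathbb{P}(X=m)\to e^{-2/p}\frac{(2/p)^m}{m!}\quad\text{as } n\to\infty.$$ *)

(* Defs.v *)
From HB Require Import structures.
From mathcomp Require Import all_boot all_order all_algebra.
From mathcomp Require Import all_classical all_reals all_analysis.

Set Implicit Arguments.
Unset Strict Implicit.
Unset Printing Implicit Defensive.

Import Order.TTheory GRing.Theory Num.Theory.
Import numFieldNormedType.Exports.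

Local Open Scope ring_scope.

Definition edge (n : nat) : finType := {e : {set 'I_n} | #|e| == 2%N}.

(* A simple graph on the vertex set 'I_n is identified with its edge set;
   in particular a spanning subgraph of G is just a subset of G. *)
Definition graph (n : nat) : finType := {set edge n}.

Section Graphs.
Variable n : nat.
Implicit Types (G T : graph n).

Definition adj G : rel 'I_n :=
  fun x y => [exists e in G, val e == [set x; y]]%SET.

Definition connected_graph G : bool :=
  [forall x, forall y, connect (adj G) x y].

(* [ucycle] also accepts the degenerate sequences [::] and [:: x; y] with
   x, y adjacent: the cycles of a simple graph are those of size >= 3. *)
Definition acyclic_graph G : bool :=
  `[< forall s : seq 'I_n, ucycle (adj G) s -> (size s < 3)%N >].

Definition tree T : bool := connected_graph T && acyclic_graph T.

Definition spanning_trees G : {set graph n} :=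
  [set T : graph n | (T \subset G) && tree T]%SET.

End Graphs.

Section Law.
Variables (R : realType) (n : nat).

Definition gnp (p : R) (G : graph n) : R :=
  \prod_(e : edge n) (if e \in G then p else 1 - p).

(* The law of a uniform spanning tree of G. When G has no spanning tree, it is
   the point mass at the empty graph: an arbitrary choice, which keeps the law
   below of total mass 1 and which [common_edges] ignores. *)
Definition ust (G T : graph n) : R :=
  if spanning_trees G == finset.set0 then (T == finset.set0)%:R
  else (T \in spanning_trees G)%:R / #|spanning_trees G|%:R.

(* An outcome is a triple (G, T1, T2). *)
Definition outcome : finType := (graph n * graph n * graph n)%type.

(* The law of (G, T1, T2), where G ~ G(n, p) and, conditionally on G, T1 and T2
   are independent uniform spanning trees of G. *)
Definition law (p : R) (w : outcome) : R :=
  let: (G, T1, T2) := w in gnp p G * (ust G T1 * ust G T2).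

Definition common_edges (w : outcome) : nat :=
  let: (G, T1, T2) := w in
  if connected_graph G then #|T1 :&: T2|%SET else 0%N.

Definition Prob (p : R) (A : pred outcome) : R := \sum_(w | A w) law p w.

Lemma gnp_ge0 p G : 0 <= p <= 1 -> 0 <= gnp p G.
Proof.
by case/andP=> p0 p1; apply: prodr_ge0 => e _; case: ifP; rewrite ?subr_ge0.
Qed.

Lemma sum_gnp p : \sum_G gnp p G = 1.
Proof.
transitivity (\prod_(e : edge n) (p + (1 - p))); last first.
  by apply: big1 => e _; rewrite addrC subrK.
by rewrite bigA_distr; apply: eq_bigl => G; rewrite inE.
Qed.

Lemma ust_ge0 G T : 0 <= ust G T.
Proof. by rewrite /ust; case: ifP => _; rewrite ?divr_ge0 ?ler0n. Qed.

Lemma sum_ust G : \sum_T ust G T = 1.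
Proof.
rewrite /ust; case: eqVneq => [_|S0].
  by rewrite (bigD1 finset.set0) //= eqxx big1 ?addr0 // => T /negbTE->.
rewrite -mulr_suml -natr_sum -big_mkcond sum1_card divff //.
by rewrite pnatr_eq0 cards_eq0.
Qed.

Lemma law_ge0 p w : 0 <= p <= 1 -> 0 <= law p w.
Proof.
by case: w => [[G T1] T2] p01; rewrite /law !mulr_ge0 ?ust_ge0 ?gnp_ge0.
Qed.

Lemma Prob_predT p : Prob p predT = 1.
Proof.
transitivity (\sum_G \sum_T1 \sum_T2 law p (G, T1, T2)).
  rewrite pair_bigA pair_bigA; apply: eq_bigr; by case=> [[G T1] T2].
rewrite -(sum_gnp p); apply: eq_bigr => G _; rewrite /law.
under eq_bigr => T1 _ do rewrite -!mulr_sumr sum_ust mulr1.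
by rewrite -mulr_sumr sum_ust mulr1.
Qed.

End Law.

(* Main.v *)
(** The number of edges M of G(n,p) is concentrated, and given M the graph is
    uniform among those with M edges; there, unlike in G(n,p) itself, the number
    tau of spanning trees is concentrated around its mean mu.  Let a_m be the
    number of pairs of spanning trees with m common edges.  The conditional law
    of X is m |-> a_m / tau^2, at distance at most |1 - tau^2 / mu^2| from
    m |-> a_m / mu^2, so it is enough to know the limit of E a_m / mu^2 and that
    these limits add up to 1, which also says that E tau^2 / mu^2 tends to 1.
    With N = n(n-1)/2, K = n-1 and h k the probability that k given edges belong
    to the graph, E a_m / mu^2 = p_m h(2K-m) / h(K)^2, where p_m is the law of
    the overlap of two uniform trees of the complete graph.  If M/N tends to p,
    the quotient tends to e^(2-2/p) p^-m, and p_m tends to e^-2 2^m / m!, hence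
    the Poisson limit.  The latter comes from the binomial moments
    S_k = sum_F P(F in T)^2 over the F of size k: P(F in T) <= (2/n)^k by the
    formula for the number of trees containing a forest, and Cauchy-Schwarz
    gives the matching lower bound, as sum_F P(F in T) = C(n-1, k). *)
Require Import Defs.
From mathcomp Require Import all_boot all_order all_algebra.
From mathcomp Require Import zify ring lra reals.
Set Implicit Arguments.
Unset Strict Implicit.
Unset Printing Implicit Defensive.
Import Order.TTheory GRing.Theory Num.Theory.

(** * Spanning trees containing a given forest *)

Section Components.
Variable n : nat.
Implicit Types (G F T : graph n) (e : edge n).

Lemma adj_sym G : symmetric (adj G).
Proof. by move=> x y; apply: eq_existsb => e; rewrite setUC. Qed.

Lemma connect_adj_sym G : connect_sym (adj G).
Proof. exact/sym_connect_sym/adj_sym. Qed.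

Lemma adjS G F x y : F \subset G -> adj F x y -> adj G x y.
Proof.
move=> /subsetP FG /existsP[e /andP[eF exy]]; apply/existsP; exists e.
by rewrite FG.
Qed.

Lemma connect_adjS G F x y :
  F \subset G -> connect (adj F) x y -> connect (adj G) x y.
Proof. by move=> FG; apply: connect_sub => u v /(adjS FG)/connect1. Qed.

Lemma edgeP e : exists x y, x != y /\ val e = [set x; y].
Proof. by have /cards2P[x [y [xy ->]]] := valP e; exists x, y. Qed.

Definition comp G x : {set 'I_n} := [set y | connect (adj G) x y].
Definition blocks G : {set {set 'I_n}} := [set comp G x | x : 'I_n].

Definition nblocks G : nat := #|blocks G|.

Lemma mem_comp G x : x \in comp G x.
Proof. by rewrite inE. Qed.

Lemma eq_comp G x y : (comp G x == comp G y) = connect (adj G) x y.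
Proof.
apply/eqP/idP => [xy|xy]; first by move: (mem_comp G y); rewrite -xy inE.
by apply/setP => z; rewrite !inE (same_connect (@connect_adj_sym G) xy).
Qed.

Lemma comp_in_blocks G x : comp G x \in blocks G.
Proof. exact: imset_f. Qed.

Lemma blocksP G B x : B \in blocks G -> x \in B -> B = comp G x.
Proof. by move=> /imsetP[y _ ->]; rewrite inE -eq_comp => /eqP. Qed.

Lemma adjU1 G e x y : val e = [set x; y] ->
  forall u v, adj (e |: G) u v =
    [|| adj G u v, (u == x) && (v == y) | (u == y) && (v == x)].
Proof.
move=> exy u v; apply/existsP/idP => [[f]|].
  rewrite in_setU1 => /andP[/orP[/eqP->|fG] fuv]; last first.
    by apply/orP; left; apply/existsP; exists f; rewrite fG.
  move: fuv; rewrite exy => /eqP/setP E.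
  have /set2P hu : u \in [set x; y] by rewrite E set21.
  have /set2P hv : v \in [set x; y] by rewrite E set22.
  have /set2P hx : x \in [set u; v] by rewrite -E set21.
  have /set2P hy : y \in [set u; v] by rewrite -E set22.
  case: hu hx hy => -> hx hy; case: hv hx hy => ->; rewrite !eqxx ?orbT //.
    by move=> _ [] ->; rewrite !eqxx ?orbT.
  by move=> [] -> _; rewrite !eqxx ?orbT.
case/or3P => [/existsP[f /andP[fG fuv]]|/andP[/eqP-> /eqP->]|/andP[/eqP->
  /eqP->]].
- by exists f; rewrite in_setU1 fG orbT.
- by exists e; rewrite setU11 exy eqxx.
- by exists e; rewrite setU11 exy setUC eqxx.
Qed.

Section AddEdge.
Variables (G : graph n) (e : edge n) (x y : 'I_n).
Hypothesis exy : val e = [set x; y].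

(** A walk that crosses the new edge several times can be shortened to one that crosses it at most
    once, in either direction. *)
Lemma connectU1 u v : connect (adj (e |: G)) u v =
  [|| connect (adj G) u v,
      connect (adj G) u x && connect (adj G) y v |
      connect (adj G) u y && connect (adj G) x v].
Proof.
have sG : G \subset e |: G by rewrite subsetU1.
have exy' : connect (adj (e |: G)) x y.
  by apply: connect1; rewrite (adjU1 G exy) !eqxx orbT.
have eyx' : connect (adj (e |: G)) y x by rewrite connect_adj_sym.
apply/idP/or3P; last first.
  case=> [|/andP[ux yv]|/andP[uy xv]]; first exact: connect_adjS.
    apply: (connect_trans (connect_adjS sG ux)).
    exact: (connect_trans exy' (connect_adjS sG yv)).
  apply: (connect_trans (connect_adjS sG uy)).
  exact: (connect_trans eyx' (connect_adjS sG xv)).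
case/connectP => p; elim: p u => [|w p IH] u /=.
  by move=> _ ->; constructor; rewrite connect0.
case/andP; rewrite (adjU1 G exy) => uw /IH{}IH /IH{IH}.
case/or3P: uw => [/connect1 uw|/andP[/eqP-> /eqP->]|/andP[/eqP-> /eqP->]].
- case=> [wv|/andP[wx yv]|/andP[wy xv]].
  + by constructor 1; apply: connect_trans uw wv.
  + by constructor 2; rewrite yv (connect_trans uw wx).
  + by constructor 3; rewrite xv (connect_trans uw wy).
- case=> [yv|/andP[yx yv]|/andP[_ xv]].
  + by constructor 2; rewrite connect0.
  + by constructor 2; rewrite connect0.
  + by constructor 1.
- case=> [yv|/andP[_ yv]|/andP[xy xv]].
  + by constructor 3; rewrite connect0.
  + by constructor 1.
  + by constructor 3; rewrite connect0.
Qed.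

Lemma blocksU1_connected : connect (adj G) x y -> blocks (e |: G) = blocks G.
Proof.
move=> xy; apply: eq_imset => u; apply/setP => v; rewrite !inE connectU1.
have yx : connect (adj G) y x by rewrite connect_adj_sym.
case: (boolP (connect _ u v)) => //= /negP uv;
  apply/negP => /orP[] /andP[H1 H2].
  by apply: uv; apply: connect_trans H1 (connect_trans xy H2).
by apply: uv; apply: connect_trans H1 (connect_trans yx H2).
Qed.

Lemma compU1 u : comp (e |: G) u =
  if u \in comp G x :|: comp G y then comp G x :|: comp G y else comp G u.
Proof.
have cs := @connect_adj_sym G.
apply/setP => v; case: ifP; rewrite !inE connectU1.
  case/orP => [xu|yu].
    rewrite -!(same_connect cs xu) connect0 /=.
    by case: (connect _ x v); case: (connect _ y v); case: (connect _ x y).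
  rewrite -!(same_connect cs yu) connect0 /=.
  by case: (connect _ x v); case: (connect _ y v); case: (connect _ y x).
by move/negbT; rewrite negb_or (cs x) (cs y) => /andP[/negbTE-> /negbTE->];
  rewrite orbF.
Qed.

Lemma blocksU1 : ~~ connect (adj G) x y ->
  blocks (e |: G) =
  (comp G x :|: comp G y) |: (blocks G :\ comp G x :\ comp G y).
Proof.
move=> nxy; apply/setP => B; apply/imsetP/idP => [[u _ ->]|].
  rewrite compU1; case: ifP; first by rewrite setU11.
  move=> /negbT; rewrite !inE negb_or -!eq_comp => /andP[xu yu].
  by rewrite comp_in_blocks ![comp G u == comp G _]eq_sym yu xu orbT.
rewrite in_setU1 => /orP[/eqP->|].
  by exists x => //; rewrite compU1 inE mem_comp.
rewrite !inE => /and3P[By Bx /imsetP[u _ E]]; exists u => //.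
rewrite compU1 ifF //; apply/negbTE; rewrite !inE negb_or -!eq_comp -E.
by rewrite eq_sym Bx eq_sym By.
Qed.

Lemma comp_disjoint : ~~ connect (adj G) x y -> [disjoint comp G x & comp G y].
Proof.
move=> nxy; rewrite disjoint_subset; apply/subsetP => u; rewrite !inE => xu.
apply: contra nxy => yu; apply: connect_trans xu _.
by rewrite connect_adj_sym.
Qed.

Lemma compU_notin : ~~ connect (adj G) x y ->
  comp G x :|: comp G y \notin blocks G :\ comp G x :\ comp G y.
Proof.
move=> nxy; rewrite !inE !negb_and !negbK.
case: (boolP (_ \in blocks G)); rewrite ?orbT //= => HB.
by rewrite (blocksP HB (x := x)) ?inE ?connect0 // eqxx orbT.
Qed.

Lemma nblocksU1 : ~~ connect (adj G) x y ->
  nblocks G = (nblocks (e |: G)).+1.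
Proof.
move=> nxy; rewrite /nblocks (blocksU1 nxy) cardsU1 compU_notin //.
rewrite (cardsD1 (comp G x)) comp_in_blocks.
rewrite (cardsD1 (comp G y) (_ :\ _)) in_setD1 comp_in_blocks.
by rewrite eq_sym eq_comp nxy.
Qed.

(** Merging components of sizes s and t turns the factor s t into s + t. Dropping one component
    keeps the size of the other, so the two summands form one contribution per end of [e];
    [sum_prod_blocksU1] then sums over vertices. *)
Lemma prod_blocksU1 : ~~ connect (adj G) x y ->
  \prod_(B in blocks (e |: G)) #|B| =
  \prod_(B in blocks G :\ comp G x) #|B| + \prod_(B in blocks G :\ comp G y)
    #|B|.
Proof.
move=> nxy; rewrite (blocksU1 nxy) big_setU1 ?compU_notin //=.
rewrite cardsU (disjoint_setI0 (comp_disjoint nxy)) cards0 subn0 addnC mulnDl.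
congr (_ + _).
  rewrite [in RHS](big_setD1 (comp G y)) // in_setD1 comp_in_blocks.
  by rewrite eq_sym eq_comp nxy.
rewrite [in RHS](big_setD1 (comp G x)) ?in_setD1 ?comp_in_blocks ?eq_comp ?nxy
  //=.
by rewrite setDDl setUC -setDDl.
Qed.

End AddEdge.

(** Euler's relation serves as definition, since it reduces inductions on edges to arithmetic.
    [acyclic_forest] and [forest_acyclic] identify it with the absence of cycles. *)
Definition forest F := nblocks F + #|F| == n.

Lemma adj0 x y : adj (set0 : graph n) x y = false.
Proof. by apply/existsP => -[e]; rewrite inE. Qed.

Lemma comp0 x : comp set0 x = [set x].
Proof.
apply/setP => y; rewrite !inE; apply/idP/eqP => [/connectP[[|z p]] //=|->//].
by rewrite adj0.
Qed.

Lemma nblocks0 : nblocks set0 = n.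
Proof.
rewrite /nblocks card_imset ?card_ord // => x y; rewrite !comp0.
by move=> /setP/(_ x); rewrite !inE eqxx => /esym/eqP.
Qed.

Lemma forest0 : forest set0.
Proof. by rewrite /forest nblocks0 cards0 addn0. Qed.

Lemma graph_ind (P : graph n -> Prop) : P set0 ->
  (forall G e, e \notin G -> P G -> P (e |: G)) -> forall G, P G.
Proof.
move=> P0 PU G; move: {2}#|G| (erefl #|G|) => k.
elim: k G => [|k IH] G; first by move/eqP; rewrite cards_eq0 => /eqP->.
move=> Gk; have /card_gt0P[e eG] : 0 < #|G| by rewrite Gk.
rewrite -(setD1K eG); apply: PU; first by rewrite setD11.
by apply: IH; move: Gk; rewrite (cardsD1 e) eG => -[].
Qed.

(** An added edge lowers the number of components by at most one; forests are the case of
    equality. *)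
Lemma nblocks_ge G : n <= nblocks G + #|G|.
Proof.
elim/graph_ind: G => [|G e eG IH]; first by rewrite nblocks0 leq_addr.
have [x [y [_ exy]]] := edgeP e; rewrite cardsU1 eG.
case: (boolP (connect (adj G) x y)) => xy.
  by rewrite /nblocks (blocksU1_connected exy xy) -/(nblocks G); lia.
by move: IH; rewrite (nblocksU1 exy xy); lia.
Qed.

Lemma forestU1 G e x y : val e = [set x; y] -> e \notin G ->
  forest (e |: G) = forest G && ~~ connect (adj G) x y.
Proof.
move=> exy eG; have := nblocks_ge G; rewrite /forest cardsU1 eG.
case: (boolP (connect (adj G) x y)) => xy.
  by rewrite /nblocks (blocksU1_connected exy xy) -/(nblocks G) andbF => H;
    apply/negbTE; lia.
by rewrite andbT (nblocksU1 exy xy) => _; congr (_ == _); lia.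
Qed.

Lemma forestS F G : F \subset G -> forest G -> forest F.
Proof.
elim/graph_ind: G F => [F|G e eG IH F]; first by rewrite subset0 => /eqP->.
have [x [y [_ exy]]] := edgeP e.
move=> sF fG; have := fG; rewrite (forestU1 exy eG) => /andP[fG' nxy].
case: (boolP (e \in F)) => eF; last first.
  by apply: IH fG'; rewrite -(setU1K eG) subsetD1 sF.
rewrite -(setD1K eF); have sF' : F :\ e \subset G by rewrite subDset.
rewrite (forestU1 exy) ?setD11 // IH //=.
by apply: contra nxy; apply: connect_adjS.
Qed.

Lemma connected_nblocks G : 0 < n -> connected_graph G = (nblocks G == 1).
Proof.
move=> n0; have x0 := Ordinal n0; apply/idP/cards1P => [/forallP cG|[B BE]].
  exists (comp G x0); apply/setP => B; rewrite inE; apply/imsetP/eqP => [|->].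
    by case=> x _ ->; apply/eqP; rewrite eq_comp; move/forallP: (cG x).
  by exists x0.
apply/forallP => x; apply/forallP => y; rewrite -eq_comp.
have := comp_in_blocks G x; have := comp_in_blocks G y.
by rewrite BE !inE => /eqP-> /eqP->.
Qed.

Lemma acyclicP G : reflect
  (forall s : seq 'I_n, ucycle (adj G) s -> size s < 3) (acyclic_graph G).
Proof. exact: boolp.asboolP. Qed.

Lemma adjD1 G e u v : adj G u v -> u \notin val e -> adj (G :\ e) u v.
Proof.
case/existsP=> f /andP[fG fuv] ue; apply/existsP; exists f; rewrite fuv andbT.
rewrite !inE fG andbT; apply: contra ue => /eqP<-.
by rewrite (eqP fuv) set21.
Qed.

(** If an added edge had its ends already connected, a simple path between them, closed up by this
    edge, would be a cycle. *)
Lemma acyclic_forest G : acyclic_graph G -> forest G.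
Proof.
elim/graph_ind: G => [|G e eG IH]; first by rewrite forest0.
have [x [y [xy exy]]] := edgeP e.
move=> /acyclicP aG; rewrite (forestU1 exy eG) IH /=; last first.
  apply/acyclicP => s /andP[cs us]; apply: aG; rewrite /ucycle us andbT.
  by apply: sub_cycle cs => u v; apply: adjS; rewrite subsetU1.
apply/negP => /connectP[p0 p0p]; case/shortenP: p0p => p pp up _ E.
have := aG (x :: p); rewrite /ucycle up andbT /= rcons_path -E.
rewrite (sub_path _ pp); last by move=> u v; apply: adjS; rewrite subsetU1.
rewrite (adjU1 G exy) !eqxx !orbT => /(_ isT).
(* Too short for a cycle: the empty path would identify the ends of [e], and a path of one edge
   would put [e] itself in [G]. *)
case: p pp up E => [|z [|]] //=; first by move=> _ _ E; rewrite E eqxx in xy.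
rewrite andbT => xz _ E _; move: xz; rewrite -E => /existsP[f /andP[fG]].
by rewrite -exy (inj_eq val_inj) => /eqP fe; rewrite -fe fG in eG.
Qed.

(** Deleting one edge of a cycle leaves its ends connected by the rest of the cycle, which
    [forestU1] forbids. *)
Lemma forest_acyclic G : forest G -> acyclic_graph G.
Proof.
move=> fG; apply/acyclicP => -[|x [|y [|z p]]] //= /andP[].
case/andP=> /existsP[e /andP[eG /eqP exy]] /andP[yz zp] us; exfalso.
have : forest (e |: (G :\ e)) by rewrite setD1K.
rewrite (forestU1 exy) ?setD11 // => /andP[_ /negP]; apply.
rewrite connect_adj_sym.
(* The other vertices of the cycle are off [e], so every edge with an end among them survives the
   deletion. *)
have zne w : w \in z :: p -> w \notin val e.
  rewrite exy !inE => wp; apply/negP => /orP[] /eqP E; move: us wp; rewrite E.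
    by rewrite cons_uniq !inE => /andP[/norP[_ /negbTE->]].
  by rewrite !cons_uniq !inE => /and3P[_ /negbTE->].
apply: (@connect_trans _ _ z).
  apply: connect1; rewrite adj_sym; apply: adjD1; first by rewrite adj_sym.
  by rewrite zne // mem_head.
elim: p z zp zne {us yz} => [|w p IH] z /=.
  by rewrite andbT => zx /(_ z) H; apply/connect1/adjD1 => //; apply: H;
    rewrite mem_head.
case/andP => zw wp H; apply: (@connect_trans _ _ w).
  by apply/connect1/adjD1 => //; apply: H; rewrite mem_head.
by apply: IH => // v vp; apply: H; rewrite inE vp orbT.
Qed.

Lemma treeE T : 0 < n -> tree T = forest T && (nblocks T == 1).
Proof.
move=> n0; rewrite /tree connected_nblocks // andbC; congr (_ && _).
by apply/idP/idP; [exact: acyclic_forest | exact: forest_acyclic].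
Qed.

Lemma tree_forest T : 0 < n -> tree T -> forest T.
Proof. by move=> n0; rewrite treeE // => /andP[]. Qed.

Lemma card_tree T : 0 < n -> tree T -> #|T| = n.-1.
Proof. by move=> n0; rewrite treeE // /forest => /andP[/eqP + /eqP E];
  rewrite E; lia. Qed.

(** * Counting the trees that contain a forest *)

Definition trees_containing F : {set graph n} :=
  [set T : graph n | tree T && (F \subset T)].

Definition joining F : {set edge n} :=
  [set e | (e \notin F) && forest (e |: F)].

(** Double counting of the pairs (T, e) with e an edge of T outside F: each T has n - 1 - |F| of
    them, one less than the number of components of F. *)
Lemma sum_trees_containing F : 0 < n -> forest F ->
  \sum_(e in joining F) #|trees_containing (e |: F)| =
  (nblocks F).-1 * #|trees_containing F|.
Proof.
move=> n0 fF.
transitivity (\sum_(e in joining F) \sum_(T in trees_containing F) (e \in T)%N).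
  apply: eq_bigr => e _; rewrite -sum1_card big_mkcond [RHS]big_mkcond;
    apply: eq_bigr => T _.
  by rewrite !inE subUset sub1set; case: (tree T); case: (e \in T);
    case: (F \subset T).
rewrite exchange_big /= mulnC -sum_nat_const; apply: eq_bigr => T.
rewrite inE => /andP[tT FT].
transitivity #|T :\: F|.
  rewrite -sum1_card big_mkcond [RHS]big_mkcond; apply: eq_bigr => e _;
    rewrite !inE.
  case: (boolP (e \in T)) => eT; rewrite ?andbF ?if_same // andbT.
  rewrite (forestS _ (tree_forest n0 tT)) ?andbT // subUset FT andbT.
  by rewrite sub1set.
rewrite cardsD (setIidPr FT) card_tree //; move/eqP: fF => fF. lia.
Qed.

(** Such an edge is determined by its other end, which ranges over the vertices outside the
    component of x. *)
Lemma card_joining_at F x : forest F ->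
  #|[set e in joining F | x \in val e]| = n - #|comp F x|.
Proof.
move=> fF; rewrite -(card_imset _ val_inj).
have -> : n - #|comp F x| = #|~: comp F x| by rewrite [RHS]cardsCs setCK
  card_ord.
rewrite -(card_in_imset (f := fun y => [set x; y])); last first.
  move=> y z; rewrite !inE => xy xz E.
  have : y \in [set x; z] by rewrite -E set22.
  by rewrite !inE => /orP[/eqP yx|/eqP//]; rewrite yx connect0 in xy.
apply: eq_card => B; apply/imsetP/imsetP => [[e]|[y]].
  rewrite !inE => /andP[/andP[eF feF] xe] ->.
  have [u [v [uv euv]]] := edgeP e.
  move: feF; rewrite (forestU1 euv eF) => /andP[_ nuv].
  move: xe; rewrite euv !inE => /orP[] /eqP->; first by exists v; rewrite ?inE.
  by exists u; rewrite 1?setUC // !inE connect_adj_sym.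
rewrite !inE => xy ->.
have nxy : x != y by apply: contra xy => /eqP->; rewrite connect0.
have sxy : #|[set x; y]| == 2 by rewrite cards2 nxy.
have [e exy] : exists e : edge n, val e = [set x; y] by exists (Sub [set x;
  y] sxy).
have eF : e \notin F.
  apply: contra xy => eF; apply: connect1; apply/existsP.
  by exists e; rewrite eF exy eqxx.
by exists e; rewrite // !inE eF (forestU1 exy eF) fF xy exy set21.
Qed.

Lemma sum_prod_blocksU1 F : forest F ->
  \sum_(e in joining F) \prod_(B in blocks (e |: F)) #|B| =
  n * (nblocks F).-1 * \prod_(B in blocks F) #|B|.
Proof.
move=> fF; pose w x := \prod_(B in blocks F :\ comp F x) #|B|.
pose W := \prod_(B in blocks F) #|B|.
have wE x : #|comp F x| * w x = W.
  by rewrite /W (big_setD1 (comp F x)) ?comp_in_blocks.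
transitivity (\sum_(e in joining F) \sum_(x in val e) w x).
  apply: eq_bigr => e; rewrite inE => /andP[eF feF].
  have [x [y [xy exy]]] := edgeP e; move: feF.
  rewrite (forestU1 exy eF) exy => /andP[_ nxy].
  by rewrite (prod_blocksU1 exy nxy) big_setU1 ?inE ?big_set1.
transitivity (\sum_x w x * (n - #|comp F x|)).
  under eq_bigr => e _ do rewrite big_mkcond.
  rewrite exchange_big /=; apply: eq_bigr => x _; rewrite -card_joining_at //.
  rewrite -big_mkcondr sum_nat_const mulnC; congr (_ * _).
  by apply: eq_card => e; rewrite [RHS]inE.
(* The s vertices of a component of size s contribute W / s each. *)
have sw : \sum_x w x = nblocks F * W.
  rewrite (partition_big_imset (comp F)) /= -sum_nat_const.
  apply: eq_bigr => B /imsetP[z _ ->]; rewrite -(wE z).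
  rewrite (eq_bigr (fun=> w z)) => [|x /eqP]; last by rewrite /w => ->.
  rewrite sum_nat_const; congr (_ * _); apply: eq_card => x.
  by rewrite !inE -eq_comp eq_sym.
have Hle : \sum_x w x * #|comp F x| = n * W.
  rewrite -[in RHS](card_ord n) -sum_nat_const; apply: eq_bigr => x _.
  by rewrite mulnC wE.
have : \sum_x w x * (n - #|comp F x|) + \sum_x w x * #|comp F x| =
  n * \sum_x w x.
  rewrite -big_split big_distrr /=; apply: eq_bigr => x _.
  by rewrite -mulnDr subnK 1?mulnC // -[X in _ <= X]card_ord max_card.
rewrite Hle sw -/W; case: (nblocks F) => [|c] /=; last by nia.
by rewrite mul0n muln0; nia.
Qed.

Lemma nblocks_gt0 F : 0 < n -> 0 < nblocks F.
Proof. by move=> n0; apply/card_gt0P; exists (comp F (Ordinal n0));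
  exact: comp_in_blocks. Qed.

(* Induction on the number of components, counting the pairs (T, e) where e is
   an edge of T outside F: joining components of sizes s and t turns the factor
   s t of the product into s + t, and these sums add up to a multiple of n. *)
Lemma card_trees_containing F : 0 < n -> forest F ->
  #|trees_containing F| * n ^ 2 = n ^ nblocks F * \prod_(B in blocks F) #|B|.
Proof.
move=> n0; move: {2}((nblocks F).-1) (erefl ((nblocks F).-1)) => k.
elim: k F => [|k IH] F ck fF; have c0 := nblocks_gt0 F n0.
  have c1 : nblocks F = 1 by lia.
  have tF : tree F by rewrite treeE // fF c1.
  have -> : trees_containing F = [set F].
    apply/setP => T; rewrite !inE; apply/idP/eqP => [/andP[tT FT]|->].
      by apply/esym/eqP; rewrite eqEcard FT (card_tree n0 tT) (card_tree n0 tF)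
        leqnn.
    by rewrite tF subxx.
  rewrite cards1 c1 expn1; have /cards1P[B BE] : nblocks F == 1 by rewrite c1.
  rewrite BE big_set1 mul1n; congr (_ * _).
  suff -> : B = setT by rewrite cardsT card_ord.
  have := connected_nblocks F n0; rewrite c1 eqxx => /forallP cF.
  have := comp_in_blocks F (Ordinal n0); rewrite BE inE => /eqP<-.
  by apply/setP => x; rewrite !inE; move/forallP: (cF (Ordinal n0)) => ->.
have /eqP := sum_trees_containing n0 fF;
  rewrite -(eqn_pmul2r (m := n ^ 2)) ?expn_gt0 ?n0 //.
rewrite big_distrl /= (eq_bigr (fun e =>
  n ^ k.+1 * \prod_(B in blocks (e |: F)) #|B|)).
  rewrite -big_distrr /= sum_prod_blocksU1 // ck => /eqP E.
  have -> : nblocks F = k.+2 by lia.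
  apply/eqP; rewrite -(eqn_pmul2l (m := k.+1)) // mulnA -E !expnS.
  by apply/eqP; ring.
move=> e; rewrite inE => /andP[eF feF].
have cE : nblocks (e |: F) = k.+1.
  move: (feF) fF; rewrite /forest cardsU1 eF => /eqP + /eqP; lia.
by rewrite IH ?cE.
Qed.

(** A size s is at most 2^(s - 1), and the exponents add up to n minus the number of components. *)
Lemma prod_blocks_le F : forest F -> \prod_(B in blocks F) #|B| <= 2 ^ #|F|.
Proof.
move=> /eqP fF.
have cardB B : B \in blocks F -> 0 < #|B|.
  by case/imsetP=> x _ ->; apply/card_gt0P; exists x; apply: mem_comp.
apply: (@leq_trans (\prod_(B in blocks F) 2 ^ #|B|.-1)).
  apply: leq_prod => B /cardB; case: #|B| => // s _ /=; exact: ltn_expl.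
rewrite -expn_sum leq_exp2l //.
suff : (\sum_(B in blocks F) #|B|.-1 + nblocks F = n)%N by lia.
rewrite /nblocks -sum1_card -big_split /=.
under eq_bigr => B HB do rewrite addn1 prednK ?cardB //.
transitivity (\sum_(x : 'I_n) 1); last by rewrite sum1_card card_ord.
rewrite (partition_big_imset (comp F)) /=; apply: eq_bigr => B /imsetP[z _ ->].
rewrite sum1_card; apply: eq_card => x; rewrite !inE -eq_comp eq_sym.
by apply/idP/idP.
Qed.

(** Dividing the formula for F by its case F empty, which is Cayley's, leaves the product of the
    component sizes over n^|F|. A set that is not a forest lies in no tree. *)
Lemma card_trees_containing_le F : 0 < n ->
  #|trees_containing F| * n ^ #|F| <= 2 ^ #|F| * #|trees_containing set0|.
Proof.
move=> n0; case: (boolP (forest F)) => fF; last first.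
  suff -> : trees_containing F = set0 by rewrite cards0.
  apply/setP => T; rewrite !inE; apply/negbTE; apply: contra fF => /andP[tT FT].
  exact: forestS FT (tree_forest n0 tT).
have n2 : 0 < n ^ 2 by rewrite expn_gt0 n0.
rewrite -(leq_pmul2r n2) -mulnA -[X in _ <= X]mulnA.
rewrite [n ^ _ * _]mulnC mulnA !card_trees_containing ?forest0 //.
rewrite nblocks0 [X in _ <= _ * (_ * X)]big1 => [|B /imsetP[x _ ->]];
  last first.
  by rewrite comp0 cards1.
rewrite muln1 mulnAC -expnD (eqP fF) mulnC leq_mul2r.
by rewrite prod_blocks_le ?orbT.
Qed.

Lemma trees_gt0 : 0 < n -> 0 < #|trees_containing set0|.
Proof.
move=> n0; have := card_trees_containing n0 forest0.
rewrite [X in _ = _ * X]big1 => [E|B /imsetP[x _ ->]];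
  last by rewrite comp0 cards1.
rewrite lt0n; apply/eqP => Z; move: E; rewrite Z muln1 mul0n => /esym/eqP.
by rewrite expn_eq0 eqn0Ngt n0.
Qed.

End Components.

(** * Overlap of two uniform trees of the complete graph *)

Lemma ffact_le_exp m k : m ^_ k <= m ^ k.
Proof.
rewrite ffact_prod -[k in _ ^ k]card_ord -prod_nat_const.
by apply: leq_prod => i _; rewrite leq_subr.
Qed.

Lemma exp_le_ffact_pred m k : (m - k) ^ k <= m.-1 ^_ k.
Proof.
rewrite ffact_prod -[X in _ ^ X]card_ord -prod_nat_const.
by apply: leq_prod => i _; have := ltn_ord i; lia.
Qed.

(** Cauchy-Schwarz: expand the square and use 2 a b <= a^2 + b^2 for each pair. *)
Lemma sum_sq_le (I : finType) (P : pred I) (f : I -> nat) :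
  (\sum_(i | P i) f i) ^ 2 <= #|P| * \sum_(i | P i) f i ^ 2.
Proof.
rewrite -(leq_pmul2l (m := 2)) // -mulnn big_distrlr big_distrr /=.
apply: (@leq_trans (\sum_(i | P i) \sum_(j | P j) (f i ^ 2 + f j ^ 2))).
  by apply: leq_sum => i _; rewrite big_distrr; apply: leq_sum => j _;
    exact: nat_Cauchy.
rewrite mul2n -addnn leq_eqVlt; apply/orP; left; apply/eqP.
under eq_bigr => i _ do rewrite big_split sum_nat_const.
by rewrite big_split /= sum_nat_const -big_distrr.
Qed.

Lemma mul_bin_trinomial m j x : m <= x ->
  'C(m + j, m) * 'C(x, m + j) = 'C(x, m) * 'C(x - m, j).
Proof.
move=> mx; have [jx|xj] := leqP (m + j) x; last first.
  by rewrite (bin_small xj) (bin_small (_ : x - m < j)) ?muln0 //; lia.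
apply/eqP; have F k : 0 < k`! := fact_gt0 k.
rewrite -(eqn_pmul2r (F m)) -(eqn_pmul2r (F j)) -(eqn_pmul2r (F (x - (m + j)))).
have := bin_fact (leq_addr j m); rewrite addKn => E1.
have E2 := bin_fact jx; have E3 := bin_fact mx.
have := @bin_fact (x - m) j; rewrite -subnDA => E4.
apply/eqP; transitivity x`!.
  by rewrite -E2 -E1; ring.
by rewrite -E3 -E4; [ring | lia].
Qed.

(** Binomial inversion: for m <= x, [mul_bin_trinomial] turns the sum into C(x, m) (1 - 1)^(x - m).
    The range only has to reach past x, as the further terms vanish. *)
Lemma eq_nat_bin_inv (R : comPzRingType) x m n : x < n ->
  ((x == m)%:R = \sum_(j < n) (-1) ^+ j * ('C(m + j, m) * 'C(x, m + j))%:R :>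
    R)%R.
Proof.
move=> xn; have [mx|xm] := leqP m x; last first.
  rewrite big1 => [|j _]; first by rewrite (ltn_eqF xm).
  by rewrite (bin_small (_ : x < m + j)) ?muln0 ?mulr0 //; lia.
under eq_bigr => j _ do rewrite mul_bin_trinomial //.
transitivity ('C(x, m)%:R * (1 - 1) ^+ (x - m) : R)%R.
  rewrite subrr expr0n; case: eqVneq => [->|xm].
    by rewrite subnn binn mulr1.
  rewrite (_ : (x - m == 0) = false) ?mulr0 //; lia.
pose F j : R := (((-1) ^+ j * 1 ^+ (x - m - j) * 1 ^+ j) *+ 'C(x - m, j))%R.
rewrite exprBn (big_ord_widen n F); last by lia.
rewrite big_mkcond big_distrr; apply: eq_bigr => j _ /=.
rewrite /F !expr1n !mulr1 natrM; case: ltnP => [_|dj].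
  by rewrite -[(_ ^+ _ *+ _)%R]mulr_natr mulrCA.
by rewrite (bin_small dj) !mulr0.
Qed.

(** * Binomial moments of the overlap *)

Section CommonEdges.
Variable n : nat.
Hypothesis n_gt0 : 0 < n.
Implicit Types (F T : graph n).

Definition trees : {set graph n} := [set T | tree T].

Lemma trees_containing0 : trees_containing set0 = trees.
Proof. by apply/setP => T; rewrite !inE sub0set andbT. Qed.

Lemma card_trees_gt0 : 0 < #|trees|.
Proof. by rewrite -trees_containing0 trees_gt0. Qed.

Lemma card_edge : #|edge n| = 'C(n, 2).
Proof. by rewrite card_sig -[n in RHS]card_ord -card_draws cardsE. Qed.

Definition sum_bin_common k : nat :=
  \sum_(T1 in trees) \sum_(T2 in trees) 'C(#|T1 :&: T2|, k).

(** Both sides count the triples (T1, T2, F) where F is a set of k edges common to both trees. *)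
Lemma sum_bin_commonE k :
  sum_bin_common k = \sum_(F : graph n | #|F| == k) #|trees_containing F| ^ 2.
Proof.
have NE F : #|trees_containing F| = \sum_(T in trees) (F \subset T)%N.
  by rewrite -sum1_card big_mkcond [RHS]big_mkcond; apply: eq_bigr => T _;
     rewrite !inE; case: (tree T); case: (F \subset T).
transitivity (\sum_(T1 in trees) \sum_(T2 in trees)
  \sum_(F : graph n | #|F| == k) (F \subset T1)%N * (F \subset T2)%N).
  apply: eq_bigr => T1 _; apply: eq_bigr => T2 _.
  rewrite -cards_draws -sum1_card big_mkcond [RHS]big_mkcond;
    apply: eq_bigr => F _.
  rewrite !inE subsetI; case: (#|F| == k); rewrite ?andbF // andbT.
  by case: (F \subset T1); case: (F \subset T2).
under eq_bigr => T1 _ do rewrite exchange_big.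
rewrite exchange_big; apply: eq_bigr => F _.
under eq_bigr => T1 _ do rewrite -big_distrr.
by rewrite -big_distrl /= -NE mulnn.
Qed.

Lemma sum_card_trees_containing k :
  \sum_(F : graph n | #|F| == k) #|trees_containing F| = #|trees| * 'C(n.-1, k).
Proof.
transitivity (\sum_(T in trees) \sum_(F : graph n | #|F| == k) (F \subset T)%N).
  rewrite exchange_big; apply: eq_bigr => F _.
  by rewrite -sum1_card big_mkcond [RHS]big_mkcond; apply: eq_bigr => T _;
     rewrite !inE; case: (tree T); case: (F \subset T).
rewrite -sum_nat_const; apply: eq_bigr => T; rewrite inE => tT.
rewrite -(card_tree n_gt0 tT) -cards_draws -sum1_card big_mkcond
  [RHS]big_mkcond.
by apply: eq_bigr => F _; rewrite !inE; case: (_ == k); case: (_ \subset _).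
Qed.

(** In each square one factor is at most (2 / n)^k times the number of trees, and the other is
    summed exactly by [sum_card_trees_containing]. *)
Lemma sum_bin_common_le k : sum_bin_common k * k`! <= 2 ^ k * #|trees| ^ 2.
Proof.
have nk : 0 < n ^ k by rewrite expn_gt0 n_gt0.
rewrite -(leq_pmul2r nk) sum_bin_commonE.
apply: (@leq_trans (2 ^ k * #|trees| * (#|trees| * 'C(n.-1, k)) * k`!)).
  rewrite mulnAC leq_mul2r -sum_card_trees_containing big_distrl big_distrr /=.
  apply/orP; right; apply: leq_sum => F /eqP Fk.
  rewrite -mulnn -mulnA mulnC leq_mul2r; apply/orP; right.
  by have := card_trees_containing_le F n_gt0; rewrite trees_containing0 Fk.
have -> : 2 ^ k * #|trees| * (#|trees| * 'C(n.-1, k)) * k`! =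
    2 ^ k * #|trees| ^ 2 * ('C(n.-1, k) * k`!) by ring.
rewrite bin_ffact leq_mul2l (leq_trans (ffact_le_exp _ _)) ?orbT //.
by case: (k) => // k'; rewrite leq_exp2r ?leq_pred.
Qed.

(** Cauchy-Schwarz over all sets of k edges. Little is lost, because for large n most of these sets
    are matchings, which all lie in the same number of trees. *)
Lemma sum_bin_common_ge k :
  2 ^ k * #|trees| ^ 2 * (n - k) ^ (2 * k) <=
  k`! * n ^ (2 * k) * sum_bin_common k.
Proof.
have CS : (#|trees| * 'C(n.-1, k)) ^ 2 <= 'C('C(n, 2), k) * sum_bin_common k.
  rewrite -sum_card_trees_containing sum_bin_commonE -card_edge -card_draws.
  set P := fun F : graph n => #|F| == k.
  have -> : #|[set A : {set edge n} | #|A| == k]| = #|P| by apply: eq_card =>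
    F; rewrite inE.
  exact: sum_sq_le.
have low : (n - k) ^ (2 * k) <= ('C(n.-1, k) * k`!) ^ 2.
  by rewrite bin_ffact mulnC expnM leq_exp2r // exp_le_ffact_pred.
have up : 2 ^ k * ('C('C(n, 2), k) * k`!) <= n ^ (2 * k).
  rewrite bin_ffact (leq_trans (leq_mul (leqnn _) (ffact_le_exp _ _))) //.
  rewrite -expnMn expnM; case: (k) => // k'; rewrite leq_exp2r // bin2 mul2n.
  have := odd_double_half (n * n.-1); rewrite -[n ^ 2]mulnn => H.
  apply: (@leq_trans (n * n.-1)); first by rewrite -[X in _ <= X]H leq_addl.
  by rewrite leq_mul2l leq_pred orbT.
apply: (@leq_trans (2 ^ k * #|trees| ^ 2 * ('C(n.-1, k) * k`!) ^ 2)).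
  by rewrite leq_mul2l low orbT.
have -> : 2 ^ k * #|trees| ^ 2 * ('C(n.-1, k) * k`!) ^ 2 =
   2 ^ k * k`! ^ 2 * (#|trees| * 'C(n.-1, k)) ^ 2 by ring.
apply: (@leq_trans (2 ^ k * k`! ^ 2 * ('C('C(n, 2), k) * sum_bin_common k))).
  by rewrite leq_mul2l CS orbT.
have -> : 2 ^ k * k`! ^ 2 * ('C('C(n, 2), k) * sum_bin_common k) =
  k`! * (2 ^ k * ('C('C(n, 2), k) * k`!)) * sum_bin_common k by ring.
by rewrite leq_mul2r leq_mul2l up !orbT.
Qed.

Definition pairs_common m : {set graph n * graph n} :=
  [set TT in setX trees trees | #|TT.1 :&: TT.2| == m].

(** Two trees share at most n - 1 edges, so the classes m < n exhaust the pairs. *)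
Lemma sum_tree_pairs (V : nmodType) (g : graph n * graph n -> V) :
  (\sum_(T1 in trees) \sum_(T2 in trees) g (T1, T2) =
  \sum_(m < n) \sum_(TT in pairs_common m) g TT)%R.
Proof.
rewrite pair_big /=.
have lt_n (TT : graph n * graph n) : TT \in setX trees trees ->
  #|TT.1 :&: TT.2| < n.
  case: TT => T1 T2; rewrite !inE => /andP[/= /(card_tree n_gt0) c1 _].
  by rewrite (leq_ltn_trans (subset_leq_card (subsetIl _ _))) // c1; lia.
transitivity (\sum_(TT in setX trees trees) \sum_(m < n)
    g TT *+ (#|TT.1 :&: TT.2| == m))%R.
  apply: eq_big => [[T1 T2]|[T1 T2] TT12]; first by rewrite !inE.
  have {}/lt_n lt : (T1, T2) \in setX trees trees by rewrite !inE in TT12 *.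
  rewrite (bigD1 (Ordinal lt)) //= eqxx mulr1n big1 ?addr0 // => m.
  by rewrite -val_eqE eq_sym /= => /negbTE->.
rewrite exchange_big; apply: eq_bigr => m _.
rewrite [RHS]big_mkcond [LHS]big_mkcond; apply: eq_bigr => TT _.
by rewrite [in RHS]inE; case: (TT \in _); case: (_ == _).
Qed.

Lemma sum_pairs_common (V : nmodType) (f : nat -> V) :
  (\sum_(T1 in trees) \sum_(T2 in trees) f #|T1 :&: T2| =
  \sum_(m < n) f m *+ #|pairs_common m|)%R.
Proof.
rewrite (sum_tree_pairs (fun TT => f #|TT.1 :&: TT.2|)); apply: eq_bigr => m _.
by rewrite -sumr_const; apply: eq_bigr => TT; rewrite inE => /andP[_ /eqP->].
Qed.

Section RealCounts.
Variable R : realFieldType.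
Local Open Scope ring_scope.

(** The law of the overlap of two independent uniform trees; [bin_moment k] is its k-th binomial
    moment. *)
Definition common_law m : R := #|pairs_common m|%:R / #|trees|%:R ^+ 2.
Definition bin_moment k : R := (sum_bin_common k)%:R / #|trees|%:R ^+ 2.

Lemma trees_sqr_gt0 : 0 < #|trees|%:R ^+ 2 :> R.
Proof. by rewrite exprn_gt0 // ltr0n card_trees_gt0. Qed.

Lemma bin_moment_sum k :
  bin_moment k = \sum_(m < n) 'C(m, k)%:R * common_law m.
Proof.
have E : (sum_bin_common k)%:R =
    \sum_(T1 in trees) \sum_(T2 in trees) 'C(#|T1 :&: T2|, k)%:R :> R.
  by rewrite natr_sum; apply: eq_bigr => T1 _; rewrite natr_sum.
rewrite /bin_moment E (sum_pairs_common (fun x => 'C(x, k)%:R)) mulr_suml.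
by apply: eq_bigr => m _; rewrite -[X in X / _]mulr_natr mulrA.
Qed.

Lemma bin_moment_ge0 k : 0 <= bin_moment k.
Proof. by rewrite /bin_moment divr_ge0 ?exprn_ge0 ?ler0n. Qed.

Lemma common_law_ge0 m : 0 <= common_law m.
Proof. by rewrite /common_law divr_ge0 ?exprn_ge0 ?ler0n. Qed.

Lemma common_law_inv m : (m < n)%N ->
  common_law m = \sum_(j < n) (-1) ^+ j * 'C(m + j, m)%:R * bin_moment (m + j).
Proof.
move=> mn; transitivity (\sum_(x < n) (val x == m)%:R * common_law x).
  rewrite (bigD1 (Ordinal mn)) //= eqxx mul1r big1 ?addr0 // => x.
  by rewrite -val_eqE /= => /negbTE->; rewrite mul0r.
under eq_bigr => x _ do rewrite (eq_nat_bin_inv _ m (ltn_ord x)) mulr_suml.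
rewrite exchange_big; apply: eq_bigr => j _; rewrite bin_moment_sum mulr_sumr.
by apply: eq_bigr => x _; rewrite natrM !mulrA.
Qed.

Lemma bin_moment_le k : bin_moment k <= 2 ^+ k / k`!%:R.
Proof.
rewrite /bin_moment ler_pdivrMr ?trees_sqr_gt0 //
  mulrAC ler_pdivlMr ?ltr0n ?fact_gt0 //.
by rewrite -!natrX -!natrM ler_nat sum_bin_common_le.
Qed.

(** The m-th binomial moment is a sum of nonnegative terms in which [common_law m] occurs with
    coefficient C(m, m) = 1. *)
Lemma common_law_le m : (m < n)%N -> common_law m <= 2 ^+ m / m`!%:R.
Proof.
move=> mn; apply: le_trans (bin_moment_le m); rewrite bin_moment_sum.
rewrite (bigD1 (Ordinal mn)) //= binn mul1r lerDl.
by apply: sumr_ge0 => i _; rewrite mulr_ge0 ?common_law_ge0.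
Qed.

Lemma bin_moment_ge k :
  2 ^+ k / k`!%:R * ((n - k)%N%:R / n%:R) ^+ (2 * k) <= bin_moment k.
Proof.
rewrite /bin_moment ler_pdivlMr ?trees_sqr_gt0 // expr_div_n.
have n0 : 0 < n%:R ^+ (2 * k) :> R by rewrite exprn_gt0 ?ltr0n.
have k0 : 0 < k`!%:R :> R by rewrite ltr0n fact_gt0.
rewrite -(ler_pM2r n0) -(ler_pM2r k0).
have -> : 2 ^+ k / k`!%:R * ((n - k)%N%:R ^+ (2 * k) / n%:R ^+ (2 * k)) *
   #|trees|%:R ^+ 2 * n%:R ^+ (2 * k) * k`!%:R =
   2 ^+ k * #|trees|%:R ^+ 2 * (n - k)%N%:R ^+ (2 * k) :> R.
  by field; rewrite ?gt_eqF.
have := sum_bin_common_ge k; rewrite -(ler_nat R) !natrM !natrX.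
by move=> /le_trans -> //; rewrite le_eqVlt; apply/orP; left; apply/eqP; ring.
Qed.

End RealCounts.
End CommonEdges.

(** * Graphs with a fixed number of edges *)

Section FixedSize.
Variables (R : realType) (n : nat).
Hypothesis n_gt0 : 0 < n.
Local Open Scope ring_scope.
Local Notation N := #|edge n|.
Implicit Types (G S T : graph n) (M m k : nat).

Definition avg M (f : graph n -> R) : R :=
  (\sum_(G : graph n | #|G| == M) f G) / 'C(N, M)%:R.

(* The probability that k given edges belong to a uniform graph with M edges:
   for k > M the truncated subtraction yields 0, as it should. *)
Definition hit M k : R := \prod_(i < k) ((M - i)%N%:R / (N - i)%N%:R).

Lemma avg_sum (I : finType) (P : pred I) M (f : I -> graph n -> R) :
  avg M (fun G => \sum_(i | P i) f i G) = \sum_(i | P i) avg M (f i).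
Proof. by rewrite /avg exchange_big mulr_suml. Qed.

Lemma avgZ M c (f : graph n -> R) : avg M (fun G => c * f G) = c * avg M f.
Proof. by rewrite /avg -mulr_sumr mulrA. Qed.

Lemma avgD M (f g : graph n -> R) :
  avg M (fun G => f G + g G) = avg M f + avg M g.
Proof. by rewrite /avg big_split mulrDl. Qed.

Lemma avgB M (f g : graph n -> R) :
  avg M (fun G => f G - g G) = avg M f - avg M g.
Proof. by rewrite /avg sumrB mulrBl. Qed.

Lemma avg1 M : (M <= N)%N -> avg M (fun=> 1) = 1.
Proof.
move=> MN; have -> : (fun=> 1) = (fun G : graph n => 1%:R : R) by [].
rewrite /avg -natr_sum sum1dep_card card_draws divff //.
by rewrite pnatr_eq0 -lt0n bin_gt0.
Qed.

Lemma ler_avg M (f g : graph n -> R) :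
  (forall G, f G <= g G) -> avg M f <= avg M g.
Proof. by move=> fg; rewrite ler_wpM2r ?invr_ge0 ?ler0n // ler_sum. Qed.

Lemma ler_avg_norm M (f : graph n -> R) : `|avg M f| <= avg M (fun G => `|f G|).
Proof.
rewrite /avg normrM [`|_^-1|]ger0_norm ?invr_ge0 ?ler0n //.
by rewrite ler_wpM2r ?invr_ge0 ?ler0n // ler_norm_sum.
Qed.

Lemma hitS M k : hit M k.+1 = hit M k * ((M - k)%N%:R / (N - k)%N%:R).
Proof. by rewrite /hit big_ord_recr. Qed.

(** The binomials count the absent edges: for k > M, [C(N - k, N - M)] vanishes like [hit M k],
    whereas a truncated lower index [M - k] would give 1. *)
Lemma bin_hit M k : (M <= N)%N -> (k <= N)%N ->
  'C(N - k, N - M)%:R = 'C(N, N - M)%:R * hit M k.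
Proof.
move=> MN; elim: k => [|k IH] kN; first by rewrite /hit big_ord0 subn0 mulr1.
have k0 : (N - k)%N%:R != 0 :> R by rewrite pnatr_eq0; lia.
rewrite hitS mulrA -IH; last by lia.
apply: (mulfI k0); rewrite subnS -natrM mul_bin_down natrM.
rewrite (_ : N - k - (N - M) = M - k)%N; last by lia.
by field.
Qed.

Lemma avg_subset M S : (M <= N)%N -> avg M (fun G =>
  (S \subset G)%:R) = hit M #|S|.
Proof.
move=> MN; rewrite /avg -natr_sum.
have -> : (\sum_(G : graph n | #|G| == M) (S \subset G) =
  'C(N - #|S|, N - M))%N.
  have -> : (N - #|S|)%N = #|~: S| by rewrite [RHS]cardsCs setCK.
  rewrite -cards_draws.
  rewrite -sum1_card [RHS](reindex_inj (inv_inj (@setCK _))) /=.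
  rewrite big_mkcond [RHS]big_mkcond; apply: eq_bigr => G _ /=.
  rewrite !inE setCS [#|~: G|]cardsCs setCK.
  rewrite (_ : (N - #|G| == N - M)%N = (#|G| == M)).
    by case: (#|G| == M); case: (S \subset G).
  by have := max_card G; lia.
rewrite bin_hit ?max_card // bin_sub // mulrAC divff ?mul1r //.
by rewrite pnatr_eq0 -lt0n bin_gt0.
Qed.

Definition ntrees G : R := #|spanning_trees G|%:R.
Definition npairs m G : R :=
  \sum_(TT in pairs_common n m) (TT.1 :|: TT.2 \subset G)%:R.

Lemma ntreesE G : ntrees G = \sum_(T in trees n) (T \subset G)%:R.
Proof.
rewrite /ntrees -sum1_card natr_sum big_mkcond [RHS]big_mkcond.
by apply: eq_bigr => T _; rewrite !inE andbC; case: (tree T);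
  case: (T \subset G).
Qed.

Lemma ntrees_sqr G : ntrees G ^+ 2 =
  \sum_(T1 in trees n) \sum_(T2 in trees n) (T1 :|: T2 \subset G)%:R.
Proof.
rewrite expr2 ntreesE big_distrlr; apply: eq_bigr => T1 _;
  apply: eq_bigr => T2 _.
by rewrite /= -natrM mulnb subUset.
Qed.

Lemma sum_npairs G : \sum_(m < n) npairs m G = ntrees G ^+ 2.
Proof.
rewrite ntrees_sqr.
by rewrite (sum_tree_pairs n_gt0 (fun TT => (TT.1 :|: TT.2 \subset G)%:R)).
Qed.

Lemma avg_ntrees M : (M <= N)%N ->
  avg M ntrees = #|trees n|%:R * hit M n.-1.
Proof.
move=> MN; have -> : avg M ntrees = avg M (fun G =>
  \sum_(T in trees n) (T \subset G)%:R).
  by congr (_ / _); apply: eq_bigr => G _; rewrite ntreesE.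
rewrite avg_sum (eq_bigr (fun=> hit M n.-1)) => [|T].
  by rewrite sumr_const mulr_natl.
by rewrite inE => /(card_tree n_gt0) <-; rewrite avg_subset.
Qed.

Lemma avg_npairs M m : (M <= N)%N ->
  avg M (npairs m) = #|pairs_common n m|%:R * hit M (n.-1.*2 - m).
Proof.
move=> MN; rewrite avg_sum (eq_bigr (fun=> hit M (n.-1.*2 - m))) => [|[T1 T2]].
  by rewrite sumr_const mulr_natl.
rewrite !inE => /andP[/andP[/= t1 t2] /= /eqP m12].
have <- : #|T1 :|: T2| = (n.-1.*2 - m)%N.
  by rewrite cardsU (card_tree n_gt0 t1) (card_tree n_gt0 t2) m12 addnn.
exact: avg_subset.
Qed.

Definition common_prob m G : R :=
  \sum_T1 \sum_T2 (ust R G T1 * ust R G T2) * (common_edges (G, T1, T2) ==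
    m)%:R.

Lemma sum_ust_pair G : \sum_T1 \sum_T2 (ust R G T1 * ust R G T2) = 1.
Proof.
by under eq_bigr => T1 _ do rewrite -mulr_sumr sum_ust mulr1; rewrite sum_ust.
Qed.

Lemma common_prob_ge0 m G : 0 <= common_prob m G.
Proof. by apply: sumr_ge0 => T1 _; apply: sumr_ge0 => T2 _;
  rewrite !mulr_ge0 ?ust_ge0 ?ler0n. Qed.

Lemma common_prob_le1 m G : common_prob m G <= 1.
Proof.
rewrite -(sum_ust_pair G); apply: ler_sum => T1 _; apply: ler_sum => T2 _.
by rewrite ler_piMr ?mulr_ge0 ?ust_ge0 // lern1 leq_b1.
Qed.

Lemma connected_graphS (F G : graph n) : F \subset G -> connected_graph F ->
  connected_graph G.
Proof.
move=> FG /forallP cF; apply/forallP => x; apply/forallP => y.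
by apply: connect_adjS FG _; move/forallP: (cF x).
Qed.

Lemma npairs_ge0 m G : 0 <= npairs m G.
Proof. by apply: sumr_ge0 => TT _; rewrite ler0n. Qed.

Lemma npairs_le m G : npairs m G <= ntrees G ^+ 2.
Proof.
rewrite ntrees_sqr pair_big /npairs big_mkcond [leRHS]big_mkcond.
apply: ler_sum => -[T1 T2] _; rewrite !inE /=.
by case: (tree T1 && tree T2); case: (_ == m); rewrite //= ler0n.
Qed.

Lemma common_probE m G : ntrees G != 0 ->
  common_prob m G = npairs m G / ntrees G ^+ 2.
Proof.
rewrite pnatr_eq0 cards_eq0 => S0.
have cG : connected_graph G.
  have /set0Pn[T] := S0; rewrite inE => /andP[TG /andP[cT _]].
  exact: connected_graphS TG cT.
rewrite /common_prob pair_bigA /npairs mulr_suml [RHS]big_mkcond.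
apply: eq_bigr => -[T1 T2] _.
rewrite /ust (negbTE S0) !inE /common_edges cG /= subUset -/(ntrees G).
case: (tree T1); case: (tree T2); case: (T1 \subset G); case: (T2 \subset G);
  case: (_ == m); rewrite /= ?mul0r ?mulr0 ?mul0r ?mulr1 //.
by rewrite !mul1r expr2 invfM.
Qed.

(* When G has no spanning tree, the right-hand side exceeds 1, so that the law
   chosen for the empty case is irrelevant. *)
Lemma common_prob_dist m (mu eps : R) G : 0 < mu -> 0 < eps ->
  `|common_prob m G - npairs m G / mu ^+ 2| <=
  (1 + eps^-1) * (1 - ntrees G / mu) ^+ 2 + eps.
Proof.
(* Replacing tau^2 by mu^2 in the denominator changes a probability by the factor 1 - tau^2 / mu^2
   of itself. For tau = 0 the bound is 1. *)
move=> mu0 eps0; apply: (@le_trans _ _ `|1 - ntrees G ^+ 2 / mu ^+ 2|).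
  have mu2 : 0 < mu ^+ 2 by rewrite exprn_gt0.
  have [t0|t0] := eqVneq (ntrees G) 0.
    have -> : npairs m G = 0.
      by apply/eqP; rewrite eq_le npairs_ge0 (le_trans (npairs_le m G)) //
        t0 expr0n.
    rewrite t0 expr0n /= !mul0r !subr0 normr1 ger0_norm ?common_prob_ge0 //.
    exact: common_prob_le1.
  have t2 : 0 < ntrees G ^+ 2 by rewrite exprn_even_gt0.
  rewrite common_probE //.
  have -> : npairs m G / ntrees G ^+ 2 - npairs m G / mu ^+ 2 =
    npairs m G / ntrees G ^+ 2 * (1 - ntrees G ^+ 2 / mu ^+ 2).
    by field; rewrite t0 gt_eqF.
  rewrite normrM ler_piMl // ger0_norm ?divr_ge0 ?npairs_ge0 ?(ltW t2) //.
  by rewrite ler_pdivrMr // mul1r npairs_le.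
rewrite -expr_div_n; set t := ntrees G / mu; set u := 1 - t.
have -> : 1 - t ^+ 2 = u * (2 - u) by rewrite /u; ring.
rewrite normrM; apply: (@le_trans _ _ (`|u| * (2 + `|u|))).
  rewrite ler_wpM2l // (le_trans (ler_normB _ _)) // ger0_norm //.
(* Completing the square gives 2 |u| <= u^2 / eps + eps, which trades the first absolute moment of u
   for the second, whose mean is computable. *)
have E : eps^-1 * u ^+ 2 + eps - 2 * `|u| = eps^-1 * (`|u| - eps) ^+ 2.
  by rewrite -[u ^+ 2]real_normK ?num_real //; field; rewrite gt_eqF.
have : 0 <= eps^-1 * (`|u| - eps) ^+ 2 by rewrite mulr_ge0 ?invr_ge0 ?(ltW
  eps0) ?sqr_ge0.
rewrite -E; have := real_normK (num_real u); nra.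
Qed.

(** The quotient of E a_m / mu^2 by p_m: two trees with m common edges occupy 2 (n - 1) - m
    edges. *)
Definition overlap_ratio M m : R := hit M (n.-1.*2 - m) / hit M n.-1 ^+ 2.

Lemma hit_gt0 M k : (k <= M)%N -> (M <= N)%N -> 0 < hit M k.
Proof.
clear n_gt0 => kM MN; apply: prodr_gt0 => i _; have := ltn_ord i => ik.
by rewrite divr_gt0 // ltr0n; lia.
Qed.

Lemma hit_ge0 M k : 0 <= hit M k.
Proof. by apply: prodr_ge0 => i _; rewrite divr_ge0 ?ler0n. Qed.

Lemma overlap_ratio_ge0 M m : 0 <= overlap_ratio M m.
Proof. by rewrite divr_ge0 ?exprn_ge0 ?hit_ge0. Qed.

(** Average [common_prob_dist]: since E tau = mu, the mean of (1 - tau / mu)^2 is E tau^2 / mu^2 -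
    1, and tau^2 is the sum of all a_j. *)
Lemma avg_common_prob_dist M m (eps : R) :
  (n.-1 <= M <= N)%N -> 0 < eps ->
  `|avg M (common_prob m) - common_law n R m * overlap_ratio M m| <=
  (1 + eps^-1) * (\sum_(j < n) common_law n R j * overlap_ratio M j - 1) + eps.
Proof.
move=> /andP[nM MN] eps0; pose mu : R := #|trees n|%:R * hit M n.-1.
have h0 := hit_gt0 nM MN.
have tr0 : 0 < #|trees n|%:R :> R by rewrite ltr0n card_trees_gt0.
have mu0 : 0 < mu by rewrite mulr_gt0.
have avgm j : avg M (fun G => npairs j G / mu ^+ 2) =
  common_law n R j * overlap_ratio M j.
  rewrite (_ : avg M _ = avg M (fun G => (mu ^+ 2)^-1 * npairs j G));
    last first.
    by congr (_ / _); apply: eq_bigr => G _; rewrite mulrC.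
  rewrite avgZ avg_npairs // /common_law /overlap_ratio /mu.
  by field; rewrite !gt_eqF.
rewrite -avgm -avgB; apply: le_trans (ler_avg_norm _ _) _.
apply: (@le_trans _ _ (avg M (fun G =>
    (1 + eps^-1) * (1 - 2 / mu * ntrees G + \sum_(j < n) npairs j G / mu ^+ 2)
      + eps * 1))).
  apply: ler_avg => G; apply: le_trans (common_prob_dist m G mu0 eps0) _.
  rewrite -mulr_suml sum_npairs le_eqVlt; apply/orP; left; apply/eqP.
  by field; rewrite !gt_eqF.
rewrite avgD (avgZ M (1 + eps^-1)) avgD avgB (avgZ M (2 / mu)) (avgZ M eps).
rewrite !avg1 // avg_ntrees // mulr1.
rewrite avg_sum; under eq_bigr => j _ do rewrite avgm.
rewrite -/mu lerD2r le_eqVlt; apply/orP; left; apply/eqP; congr (_ * _).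
by field; rewrite !gt_eqF.
Qed.

End FixedSize.

From mathcomp Require Import all_classical all_reals all_analysis.
Import Order.TTheory GRing.Theory Num.Theory.
Import numFieldNormedType.Exports.
Local Open Scope classical_set_scope.
Local Open Scope ring_scope.

(** * Limits *)

Section Limits.
Variable R : realType.
Implicit Types (a b f g : nat -> R) (x p c : R).

Lemma series_expR_cvg x : series (exp_coeff x) @ \oo --> expR x.
Proof. exact: is_cvg_series_exp_coeff. Qed.

Lemma cvg_sum_ord J (f : nat -> nat -> R) g :
  (forall j, f ^~ j @ \oo --> g j) ->
  (fun n => \sum_(j < J) f n j) @ \oo --> \sum_(j < J) g j.
Proof.
move=> fg; elim: J => [|J IH].
  rewrite big_ord0 (_ : (fun _ => _) = fun=> 0); first exact: cvg_cst.
  by apply/funext => n; rewrite big_ord0.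
rewrite big_ord_recr (_ : (fun _ => _) = (fun n => \sum_(j < J) f n j + f n J)).
  exact: cvgD.
by apply/funext => n; rewrite big_ord_recr.
Qed.

(** Dominated convergence for sums whose length grows with n: cut at an index J beyond which both
    series have small tails. *)
Lemma tannery (f : nat -> nat -> R) g b (l : R) :
  (forall j, f ^~ j @ \oo --> g j) -> series g @ \oo --> l ->
  (\forall n \near \oo, forall j, (j < n)%N -> `|f n j| <= b j) ->
  (forall j, 0 <= b j) -> cvgn (series b) ->
  (fun n => \sum_(j < n) f n j) @ \oo --> l.
Proof.
move=> fg gl fb b0 bB; apply/cvgrPdist_le => e e0.
have e4 : 0 < e / 4 by rewrite divr_gt0.
(* One quarter of e goes to the tail of g, one to the first J terms, and two to the partial sums of
   b between J and n. *)
have [J HJ] : exists J, forall n, (J <= n)%N ->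
    `|l - series g n| <= e / 4 /\ `|limn (series b) - series b n| <= e / 4.
  have [J _ HJ] : \forall n \near \oo, `|l - series g n| <= e / 4 /\
      `|limn (series b) - series b n| <= e / 4.
    near=> n; split; near: n.
      by move/cvgrPdist_le: gl; apply.
    by move/cvgrPdist_le: bB; apply.
  by exists J => n; apply: HJ.
have sJ := cvg_sum_ord (J := J) fg.
near=> n.
have Jn : (J <= n)%N by near: n; exact: nbhs_infty_ge.
have fbn : forall j, (j < n)%N -> `|f n j| <= b j by near: n.
have sJn : `|\sum_(j < J) g j - \sum_(j < J) f n j| <= e / 4.
  by near: n; move/cvgrPdist_le: sJ; apply.
have [gJ bJ] := HJ J (leqnn J); have [_ bn] := HJ n Jn.
have -> : \sum_(j < n) f n j = \sum_(j < J) f n j + \sum_(J <= j < n) f n j.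
  by rewrite -!(big_mkord xpredT) -big_cat_nat.
have tail : `|\sum_(J <= j < n) f n j| <= series b n - series b J.
  rewrite sub_series_geq // (le_trans (ler_norm_sum _ _ _)) //.
  by rewrite !big_nat; apply: ler_sum => j /andP[_ /fbn].
have gE : series g J = \sum_(j < J) g j by rewrite /series /= big_mkord.
rewrite gE in gJ.
move: gJ bJ bn sJn tail; rewrite !ler_norml.
move=> /andP[? ?] /andP[? ?] /andP[? ?] /andP[? ?] /andP[? ?].
apply/andP; split; lra.
Unshelve. all: by end_near. Qed.

Lemma cvg_natrV : (fun n => n%:R^-1 : R) @ \oo --> (0 : R).
Proof.
rewrite -(cvg_shiftn 1) (_ : (fun _ => _) = @harmonic R);
  first exact: cvg_harmonic.
by apply/funext => n; rewrite addn1.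
Qed.

Lemma cvg_exprn k f x : f @ \oo --> x -> (fun n => f n ^+ k) @ \oo --> x ^+ k.
Proof.
move=> fx; elim: k => [|k IH].
  exact: cvg_cst.
rewrite exprS (_ : (fun _ => _) = (fun n => f n * f n ^+ k)); first exact: cvgM.
by apply/funext => n; rewrite exprS.
Qed.

Lemma cvg_subn_ratio k : (fun n => (n - k)%N%:R / n%:R : R) @ \oo --> (1 : R).
Proof.
have : (fun n => 1 - k%:R * n%:R^-1 : R) @ \oo --> (1 - k%:R * 0 : R).
  by apply: cvgB; [exact: cvg_cst | apply: cvgMl_tmp; exact: cvg_natrV].
rewrite mulr0 subr0; apply: cvg_trans; apply: near_eq_cvg; near=> n.
have kn : (k < n)%N by near: n; exact: nbhs_infty_gt.
have n0 : n%:R != 0 :> R by rewrite pnatr_eq0; lia.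
by rewrite natrB 1?ltnW //; field.
Unshelve. all: by end_near. Qed.

Lemma bin_moment_cvg k :
  (fun n => bin_moment n R k) @ \oo --> (2 ^+ k / k`!%:R : R).
Proof.
apply: (@squeeze_cvgr _ _ _ _
  (fun n => 2 ^+ k / k`!%:R * ((n - k)%N%:R / n%:R) ^+ (2 * k))
  (fun=> 2 ^+ k / k`!%:R)).
- near=> n; have n0 : (0 < n)%N by near: n; exact: nbhs_infty_gt.
  by rewrite bin_moment_ge //= bin_moment_le.
- have : (fun n => 2 ^+ k / k`!%:R * ((n - k)%N%:R / n%:R) ^+ (2 * k)) @ \oo -->
      (2 ^+ k / k`!%:R * 1 ^+ (2 * k) : R).
    by apply: cvgMl_tmp; apply: cvg_exprn; exact: cvg_subn_ratio.
  by rewrite expr1n mulr1.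
- exact: cvg_cst.
Unshelve. all: by end_near. Qed.

(** Termwise limit in [common_law_inv]: by [fE] the j-th term is bounded by 2^m / m! times 2^j / j!,
    and tends to this with the sign (-1)^j, which sums to the series of exp (- 2). *)
Lemma common_law_cvg m :
  (fun n => common_law n R m) @ \oo --> (2 ^+ m / m`!%:R * expR (- 2) : R).
Proof.
have m0 : m`!%:R != 0 :> R by rewrite pnatr_eq0 -lt0n fact_gt0.
have fE j : 'C(m + j, m)%:R * (2 ^+ (m + j) / (m + j)`!%:R) =
    2 ^+ m / m`!%:R * exp_coeff 2 j :> R.
  have j0 : j`!%:R != 0 :> R by rewrite pnatr_eq0 -lt0n fact_gt0.
  rewrite /exp_coeff /= -(bin_fact (leq_addr j m)) addKn !natrM exprD.
  have b0 : 'C(m + j, m)%:R != 0 :> R by rewrite pnatr_eq0 -lt0n bin_gt0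
    leq_addr.
  by field; rewrite m0 j0.
suff main : (fun n => \sum_(j < n) (-1) ^+ j * 'C(m + j, m)%:R *
    bin_moment n R (m + j)) @ \oo --> (2 ^+ m / m`!%:R * expR (- 2) : R).
  apply: cvg_trans main; apply: near_eq_cvg; near=> n;
    have mn : (m < n)%N by near: n; exact: nbhs_infty_gt.
  by rewrite [RHS]common_law_inv // (leq_ltn_trans _ mn).
apply: (@tannery (fun n j => (-1) ^+ j * 'C(m + j, m)%:R * bin_moment n R (m +
  j)) (fun j => 2 ^+ m / m`!%:R * exp_coeff (- 2) j)
   (fun j => 2 ^+ m / m`!%:R * exp_coeff 2 j)).
- move=> j; have -> : 2 ^+ m / m`!%:R * exp_coeff (- 2) j =
    (-1) ^+ j * 'C(m + j, m)%:R * (2 ^+ (m + j) / (m + j)`!%:R) :> R.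
    by rewrite -[RHS]mulrA fE /exp_coeff /= (exprNn 2) [RHS]mulrCA !mulrA.
  by apply: cvgMl_tmp; exact: bin_moment_cvg.
- have -> : series (fun j => 2 ^+ m / m`!%:R * exp_coeff (- 2) j) =
     (fun n => 2 ^+ m / m`!%:R * series (exp_coeff (- 2)) n) :> (nat -> R).
    by apply/funext => n; rewrite /series /= mulr_sumr.
  by apply: cvgMl_tmp; exact: series_expR_cvg.
- near=> n; have n0 : (0 < n)%N by near: n; exact: nbhs_infty_gt.
  move=> j _; rewrite -fE normrM [`|bin_moment _ _ _|]ger0_norm ?bin_moment_ge0
    //.
  by rewrite normrM normrX normrN1 expr1n mul1r normr_nat ler_wpM2l
    ?bin_moment_le.
- by move=> j; rewrite mulr_ge0 ?exp_coeff_ge0 // divr_ge0 ?exprn_ge0.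
- have -> : series (fun j => 2 ^+ m / m`!%:R * exp_coeff 2 j) =
     (fun n => 2 ^+ m / m`!%:R * series (exp_coeff 2) n) :> (nat -> R).
    by apply/funext => n; rewrite /series /= mulr_sumr.
  apply/cvg_ex; exists (2 ^+ m / m`!%:R * expR 2).
  by apply: cvgMl_tmp; exact: series_expR_cvg.
Unshelve. all: by end_near. Qed.
End Limits.

(** * Exponential limits of products of ratios *)

Section Overlap.
Variable R : realType.

(** Each of the K factors is 1 - K / (X - i), at most exp (- K / X), and its inverse 1 + K / (X - K
    - i) is at most exp (K / (X - 2 K)). *)
Lemma prod_ratio_bounds (X K : nat) : (K.*2 < X)%N ->
  expR (- (K%:R ^+ 2 / (X%:R - 2 * K%:R)) : R) <=
  \prod_(i < K) ((X - K - i)%N%:R / (X - i)%N%:R) <=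
    expR (- (K%:R ^+ 2 / X%:R) : R).
Proof.
rewrite -addnn => KX.
have X0 : 0 < X%:R :> R by rewrite ltr0n; lia.
have XK : 0 < X%:R - 2 * K%:R :> R.
  by rewrite subr_gt0 -natrM ltr_nat; lia.
have E (y : R) : expR (- (K%:R ^+ 2 / y)) = \prod_(i < K) expR (- (K%:R / y)).
  by rewrite prodr_const card_ord -expRM_natl mulrN expr2 mulrA.
have fact i : (i < K)%N -> [/\ 0 <= i%:R :> R, i%:R < K%:R :> R,
    (X - K - i)%N%:R = X%:R - K%:R - i%:R :> R & (X - i)%N%:R =
      X%:R - i%:R :> R].
  move=> iK; rewrite !natrB ?ltr_nat ?iK ?ler0n //; lia.
rewrite !E; apply/andP; split; apply: ler_prod => i _.
  have [i0 iK -> ->] := fact i (ltn_ord i); rewrite expR_ge0 expRN /=.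
  rewrite -[leRHS]invrK lef_pV2 ?posrE ?expR_gt0 ?invr_gt0 ?divr_gt0 //;
    try lra.
  apply: le_trans (_ : 1 + K%:R / (X%:R - 2 * K%:R) <= _);
    last exact: expR_ge1Dx.
  have -> : ((X%:R - K%:R - i%:R) / (X%:R - i%:R))^-1 =
      1 + K%:R / (X%:R - K%:R - i%:R) :> R.
    by field; apply/andP; split; rewrite gt_eqF //; lra.
  rewrite lerD2l ler_wpM2l // lef_pV2 ?posrE //; lra.
have [i0 iK -> ->] := fact i (ltn_ord i).
apply/andP; split; first by apply: divr_ge0; lra.
apply: le_trans (expR_ge1Dx _).
have -> : (X%:R - K%:R - i%:R) / (X%:R - i%:R) = 1 - K%:R / (X%:R - i%:R) :> R.
  by field; rewrite gt_eqF //; lra.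
rewrite lerD2l lerN2 ler_wpM2l // lef_pV2 ?posrE //; lra.
Qed.

(** With X asymptotic to s K^2, both exponents of [prod_ratio_bounds] tend to - 1 / s, as 2 K is of
    lower order. *)
Lemma prod_ratio_cvg (X K : nat -> nat) (s : R) : 0 < s ->
  (fun n => (K n)%:R^-1) @ \oo --> (0 : R) ->
  (fun n => (X n)%:R / (K n)%:R ^+ 2) @ \oo --> s ->
  (fun n => \prod_(i < K n) ((X n - K n - i)%N%:R / (X n - i)%N%:R)) @ \oo -->
    (expR (- s^-1) : R).
Proof.
move=> s0 K0 Xs.
have sK : (fun n => (X n)%:R / (K n)%:R ^+ 2 - 2 * (K n)%:R^-1) @ \oo --> s.
  by rewrite -[X in _ --> X]subr0 -[X in _ --> _ - X](mulr0 2);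
    apply: cvgB => //; exact: cvgMl_tmp.
have s_neq0 : s != 0 by rewrite gt_eqF.
have exp_cvg (u : nat -> R) : u @ \oo --> s ->
    (fun n => expR (- (u n)^-1)) @ \oo --> expR (- s^-1).
  move=> us; apply: continuous_cvg; first exact: continuous_expR.
  by apply: cvgN; apply: cvgV.
apply: squeeze_cvgr (exp_cvg _ sK) (exp_cvg _ Xs).
near=> n.
have pos : 0 < (X n)%:R / (K n)%:R ^+ 2 - 2 * (K n)%:R^-1 :> R.
  by near: n; exact: (cvgr_gt _ sK).
(* At K = 0 all the inverses have the default value 0, against [pos]. *)
have K_gt0 : (K n)%:R != 0 :> R.
  by apply/eqP => Kn; move: pos; rewrite Kn expr0n /= invr0 !mulr0 subrr ltxx.
have KX : ((K n).*2 < X n)%N.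
  move: pos; have -> : (X n)%:R / (K n)%:R ^+ 2 - 2 * (K n)%:R^-1 =
    ((X n)%:R - 2 * (K n)%:R) / (K n)%:R ^+ 2 :> R by field.
  rewrite pmulr_lgt0 ?invr_gt0 ?exprn_even_gt0 //.
  by rewrite subr_gt0 -natrM ltr_nat mul2n.
have -> : ((X n)%:R / (K n)%:R ^+ 2 - 2 * (K n)%:R^-1)^-1 =
    (K n)%:R ^+ 2 / ((X n)%:R - 2 * (K n)%:R) :> R.
  field; rewrite K_gt0 /= subr_eq0 -natrM eqr_nat; apply/andP; split; lia.
by rewrite invf_div prod_ratio_bounds.
Unshelve. all: by end_near. Qed.

End Overlap.

(** * Limits along edge numbers of density p *)

Section EdgeDensity.
Variables (R : realType) (p : R) (M : nat -> nat).
Local Notation K n := (n.-1).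

Definition edge_density := [/\ 0 < p, forall n, (M n <= #|edge n|)%N &
  (fun n => (M n)%:R / #|edge n|%:R) @ \oo --> p].

Lemma cvg_predV : (fun n => (K n)%:R^-1 : R) @ \oo --> (0 : R).
Proof.
rewrite -(cvg_shiftn 1) (_ : (fun _ => _) = (fun n => n%:R^-1));
  first exact: cvg_natrV.
by apply/funext => n; rewrite addn1.
Qed.

Lemma edge_natr n : (1 < n)%N ->
  #|edge n|%:R = (K n)%:R * ((K n)%:R + 1) / 2 :> R.
Proof.
case: n => [|n] // _; rewrite /= card_edge; apply: (mulIf (x := 2)) => //.
rewrite divfK // natr1 -!natrM muln2 bin2 /= halfK oddM /= andNb subn0.
by rewrite mulnC.
Qed.

Lemma edge_cvg : (fun n => #|edge n|%:R / (K n)%:R ^+ 2) @ \oo --> (2^-1 : R).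
Proof.
have : (fun n => 2^-1 + 2^-1 * (K n)%:R^-1) @ \oo --> (2^-1 + 2^-1 * 0 : R).
  by apply: cvgD; [exact: cvg_cst | apply: cvgMl_tmp; exact: cvg_predV].
rewrite mulr0 addr0; apply: cvg_trans; apply: near_eq_cvg; near=> n.
have n1 : (1 < n)%N by near: n; exact: nbhs_infty_gt.
have Kn : (K n)%:R != 0 :> R by rewrite pnatr_eq0; lia.
by rewrite edge_natr //; field.
Unshelve. all: by end_near. Qed.

Lemma edges_cvg : edge_density -> (fun n =>
  (M n)%:R / (K n)%:R ^+ 2) @ \oo --> p / 2.
Proof.
move=> dM; have [p0 MN Mp] := dM.
have lim : (fun n => (M n)%:R / #|edge n|%:R * (#|edge n|%:R / (K n)%:R ^+ 2))
  @ \oo -->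
    (p / 2 : R) by exact: cvgM Mp edge_cvg.
apply: cvg_trans lim; apply: near_eq_cvg; near=> n.
have n1 : (1 < n)%N by near: n; exact: nbhs_infty_gt.
have Kn : (K n)%:R != 0 :> R by rewrite pnatr_eq0; lia.
have En : #|edge n|%:R != 0 :> R by rewrite pnatr_eq0 -lt0n card_edge bin_gt0.
by field; rewrite ?Kn ?En.
Unshelve. all: by end_near. Qed.

Lemma pred_edge_cvg : (fun n => (K n).*2%:R / #|edge n|%:R) @ \oo --> (0 : R).
Proof.
have h2 : (2^-1 : R) != 0 by rewrite invr_eq0.
have lim : (fun n => 2 * ((#|edge n|%:R / (K n)%:R ^+ 2)^-1 * (K n)%:R^-1)) @
  \oo -->
    (2 * ((2^-1)^-1 * 0) : R).
  by apply: cvgMl_tmp; apply: cvgM;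
    [exact: cvgV h2 edge_cvg | exact: cvg_predV].
rewrite !mulr0 in lim; apply: cvg_trans lim; apply: near_eq_cvg; near=> n.
have n1 : (1 < n)%N by near: n; exact: nbhs_infty_gt.
have Kn : (K n)%:R != 0 :> R by rewrite pnatr_eq0; lia.
have En : #|edge n|%:R != 0 :> R by rewrite pnatr_eq0 -lt0n card_edge bin_gt0.
by rewrite -mul2n natrM; field; rewrite ?Kn ?En.
Unshelve. all: by end_near. Qed.

Lemma edges_sub_cvg : edge_density ->
  (fun n => ((M n)%:R - (K n).*2%:R) / #|edge n|%:R) @ \oo --> p.
Proof.
move=> dM; have [p0 MN Mp] := dM.
rewrite (_ : (fun _ => _) =
    (fun n => (M n)%:R / #|edge n|%:R - (K n).*2%:R / #|edge n|%:R));
      last first.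
  by apply/funext => n; rewrite mulrBl.
by rewrite -[p]subr0; apply: cvgB; [exact: Mp | exact: pred_edge_cvg].
Qed.

(** M is quadratic in n. Once the inequality holds, no subtraction is truncated in [hit] for up to 2
    (n - 1) edges. *)
Lemma near_double_lt : edge_density -> \forall n \near \oo, ((K n).*2 < M n)%N.
Proof.
move=> dM; have [p0 MN Mp] := dM.
near=> n; have : 0 < ((M n)%:R - (K n).*2%:R) / #|edge n|%:R :> R.
  by near: n; exact: (cvgr_gt _ (edges_sub_cvg dM)).
case: (posnP #|edge n|) => [->|E0]; first by rewrite invr0 mulr0 ltxx.
by rewrite pmulr_lgt0 ?invr_gt0 ?ltr0n // subr_gt0 ltr_nat.
Unshelve. all: by end_near. Qed.

Lemma hitD n m i j : hit R n m (i + j) =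
  hit R n m i * \prod_(l < j) ((m - i - l)%N%:R / (#|edge n| - i - l)%N%:R).
Proof.
elim: j => [|j IH]; first by rewrite addn0 big_ord0 mulr1.
rewrite addnS hitS IH -mulrA [in RHS]big_ord_recr; congr (_ * (_ * _)).
by rewrite !subnDA.
Qed.

(** With K = n - 1, h(2K) / h(K)^2 is the product of [prod_ratio_cvg] for X = M over the one for X =
    N. As M and N are asymptotic to p K^2 / 2 and K^2 / 2, these tend to exp (- 2 / p) and exp (-
    2). *)
Lemma overlap_ratio0_cvg : edge_density ->
  (fun n => overlap_ratio R n (M n) 0) @ \oo --> expR (2 - 2 / p).
Proof.
move=> dM; have [p0 MN Mp] := dM.
have p2 : 0 < p / 2 by rewrite divr_gt0.
have h2 : (0 : R) < 2^-1 by rewrite invr_gt0.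
have AM := prod_ratio_cvg p2 cvg_predV (edges_cvg dM).
have AN := prod_ratio_cvg h2 cvg_predV edge_cvg.
have e0 : expR (- (2^-1)^-1) != 0 :> R by rewrite expR_eq0.
have <- : expR (- (p / 2)^-1) * (expR (- (2^-1)^-1))^-1 = expR (2 - 2 / p).
  by rewrite -expRN -expRD opprK invrK invf_div addrC.
apply: cvg_trans (cvgM AM (cvgV e0 AN)); apply: near_eq_cvg; near=> n.
have KM : ((K n).*2 < M n)%N by near: n; exact: (near_double_lt dM).
have h0 : hit R n (M n) (K n) != 0 by rewrite gt_eqF // hit_gt0 ?MN //
  (leq_trans _ (ltnW KM)) // -addnn leq_addr.
rewrite /overlap_ratio subn0 -addnn hitD expr2 -mulf_div divff // mul1r.
rewrite /hit /= -!prodfV -!big_split /=.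
apply: eq_bigr => i _.
by rewrite !invf_div [LHS]mulrACA [RHS]mulrACA [X in _ * X]mulrC.
Unshelve. all: by end_near. Qed.

(** One more common edge removes from [hit] its last factor (M - k) / (N - k). *)
Lemma overlap_ratioS n m : edge_density -> (m < (K n).*2)%N ->
  ((K n).*2 < M n)%N ->
  let k := ((K n).*2 - m.+1)%N in
  overlap_ratio R n (M n) m.+1 = overlap_ratio R n (M n) m *
    ((#|edge n|%:R - k%:R) / ((M n)%:R - k%:R)).
Proof.
move=> dM; have [p0 MN Mp] := dM.
move=> mK KM k; have -> : overlap_ratio R n (M n) m =
  overlap_ratio R n (M n) m.+1 * (((M n)%:R - k%:R) / (#|edge n|%:R - k%:R)).
  rewrite /overlap_ratio -/k (_ : ((K n).*2 - m)%N = k.+1); last by rewrite /k;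
    lia.
  rewrite hitS !natrB ?(leq_trans _ (MN n)) //; try (rewrite /k; lia).
  by rewrite mulrAC.
have kM : 0 < (M n)%:R - k%:R :> R by rewrite subr_gt0 ltr_nat /k; lia.
have := MN n; rewrite -(ler_nat R) => ?.
by field; rewrite !gt_eqF //; lra.
Qed.

(** Since k <= 2 (n - 1) is negligible against N, the factor in [overlap_ratioS] tends to 1 / p. *)
Lemma overlap_ratio_cvg m : edge_density ->
  (fun n => overlap_ratio R n (M n) m) @ \oo --> expR (2 - 2 / p) * p^-1 ^+ m.
Proof.
move=> dM; have [p0 MN Mp] := dM.
elim: m => [|m IH]; first by rewrite expr0 mulr1;
  exact: (overlap_ratio0_cvg dM).
pose k n := ((K n).*2 - m.+1)%N.
have kE : (fun n => (k n)%:R / #|edge n|%:R) @ \oo --> (0 : R).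
  apply: squeeze_cvgr (@cvg_cst _ _ _ _ _) pred_edge_cvg; near=> n.
  by rewrite divr_ge0 //= ler_wpM2r ?invr_ge0 // ler_nat leq_subr.
have pz : p != 0 by rewrite gt_eqF.
have den : (fun n => (M n)%:R / #|edge n|%:R - (k n)%:R / #|edge n|%:R) @ \oo
  --> p.
  by rewrite -[p]subr0; apply: cvgB; [exact: Mp | exact: kE].
have num : (fun n => 1 - (k n)%:R / #|edge n|%:R) @ \oo --> (1 : R).
  have lim : (fun n => 1 - (k n)%:R / #|edge n|%:R) @ \oo --> (1 - 0 : R).
    by apply: cvgB; [exact: cvg_cst | exact: kE].
  by rewrite subr0 in lim.
have -> : expR (2 - 2 / p) * p^-1 ^+ m.+1 =
  expR (2 - 2 / p) * p^-1 ^+ m * (1 * p^-1).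
  by rewrite mul1r exprSr mulrA.
apply: cvg_trans (cvgM IH (cvgM num (cvgV pz den))); apply: near_eq_cvg;
  near=> n.
have KM : ((K n).*2 < M n)%N by near: n; exact: (near_double_lt dM).
have mn : (m.+1 < n)%N by near: n; exact: nbhs_infty_gt.
have E0 : #|edge n|%:R != 0 :> R by rewrite pnatr_eq0; have := MN n; lia.
rewrite (overlap_ratioS dM) //=; last by lia.
rewrite -/(k n); congr (_ * _).
have k0 : (M n)%:R - (k n)%:R != 0 :> R.
  by rewrite subr_eq0 eqr_nat /k; lia.
by field; rewrite k0 E0.
Unshelve. all: by end_near. Qed.

(** The factor in [overlap_ratioS] is at most N / (M - 2 (n - 1)), eventually at most 2 / p. A
    geometric bound uniform in m is enough for domination, because the bound on [common_law] decays
    factorially. *)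
Lemma overlap_ratio_bound : edge_density ->
  \forall n \near \oo, forall m, (m < n)%N ->
  overlap_ratio R n (M n) m <= (expR (2 - 2 / p) + 1) * (2 / p) ^+ m.
Proof.
move=> dM; have [p0 MN Mp] := dM.
near=> n.
have KM : ((K n).*2 < M n)%N by near: n; exact: (near_double_lt dM).
have b0 : overlap_ratio R n (M n) 0 <= expR (2 - 2 / p) + 1.
  near: n; apply: (cvgr_le _ (overlap_ratio0_cvg dM)); lra.
have bp : p / 2 <= ((M n)%:R - (K n).*2%:R) / #|edge n|%:R.
  near: n; apply: (cvgr_ge _ (edges_sub_cvg dM)); lra.
have E0 : 0 < #|edge n|%:R :> R by rewrite ltr0n; have := MN n; lia.
elim=> [|m IH] mn; first by rewrite expr0 mulr1.
rewrite (overlap_ratioS dM) //; last by lia.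
rewrite exprSr [leRHS]mulrA; set k := ((K n).*2 - m.+1)%N.
have kK : k%:R <= (K n).*2%:R :> R by rewrite ler_nat leq_subr.
have KM' : (K n).*2%:R < (M n)%:R :> R by rewrite ltr_nat.
have := MN n; rewrite -(ler_nat R) => MNn.
have k0 : 0 <= k%:R :> R by rewrite ler0n.
apply: ler_pM; last 2 first.
- by apply: IH; lia.
- rewrite ler_pdivrMr; last by lra.
  rewrite mulrAC ler_pdivlMr //; move: bp; rewrite ler_pdivlMr // => bp.
  nra.
- exact: overlap_ratio_ge0.
- by rewrite divr_ge0 //; lra.
Unshelve. all: by end_near. Qed.

(** This is E tau^2 / mu^2 tending to 1: the termwise limits are the Poisson probabilities, and C (4
    / p)^j / j! dominates. *)
Lemma sum_overlap_cvg : edge_density -> (fun n => \sum_(j < n)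
   common_law n R j * overlap_ratio R n (M n) j) @ \oo --> (1 : R).
Proof.
move=> dM; have [p0 MN Mp] := dM.
pose C := expR (2 - 2 / p) + 1.
have C0 : 0 < C by rewrite addr_gt0 ?expR_gt0.
have serZ c x : series (fun j => c * exp_coeff x j) @ \oo --> (c * expR x : R).
  rewrite (_ : series _ = (fun n => c * series (exp_coeff x) n)).
    by apply: cvgMl_tmp; exact: series_expR_cvg.
  by apply/funext => n; rewrite /series /= mulr_sumr.
apply: (@tannery _ (fun n j => common_law n R j * overlap_ratio R n (M n) j)
   (fun j => expR (- (2 / p)) * exp_coeff (2 / p) j)
   (fun j => C * exp_coeff (2 * (2 / p)) j)).
- move=> j; have -> : expR (- (2 / p)) * exp_coeff (2 / p) j =
    2 ^+ j / j`!%:R * expR (- 2) * (expR (2 - 2 / p) * p^-1 ^+ j).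
    have -> : expR (- (2 / p)) = expR (- 2) * expR (2 - 2 / p).
      by rewrite -expRD; congr expR; ring.
    by rewrite /exp_coeff /= exprMn; ring.
  by apply: cvgM; [exact: common_law_cvg | exact: (overlap_ratio_cvg dM)].
- have := serZ (expR (- (2 / p))) (2 / p).
  by rewrite [expR _ * expR _]mulrC expRxMexpNx_1.
- near=> n => j jn.
  have n0 : (0 < n)%N by lia.
  have r0 := overlap_ratio_ge0 R n (M n) j.
  have rb : overlap_ratio R n (M n) j <= C * (2 / p) ^+ j.
    by move: j jn {r0}; near: n; exact: (overlap_ratio_bound dM).
  rewrite ger0_norm; last exact: mulr_ge0 (common_law_ge0 _ _ _) r0.
  have -> : C * exp_coeff (2 * (2 / p)) j =
    2 ^+ j / j`!%:R * (C * (2 / p) ^+ j).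
    by rewrite /exp_coeff /= exprMn; ring.
  apply: ler_pM => //; [exact: common_law_ge0 | exact: common_law_le].
- by move=> j; rewrite mulr_ge0 ?(ltW C0) ?exp_coeff_ge0 // mulr_ge0 //
  divr_ge0 // ltW.
- by apply/cvg_ex; eexists; exact: serZ.
Unshelve. all: by end_near. Qed.

Lemma avg_common_prob_cvg m : edge_density ->
  (fun n => avg (M n) (@common_prob R n m)) @ \oo -->
    expR (- (2 / p)) * ((2 / p) ^+ m / m`!%:R).
Proof.
move=> dM; have [p0 MN Mp] := dM.
set l := (X in _ --> X).
have main : (fun n => common_law n R m * overlap_ratio R n (M n) m) @ \oo --> l.
  have -> : l = 2 ^+ m / m`!%:R * expR (- 2) * (expR (2 - 2 / p) * p^-1 ^+ m).
    have E : expR (- (2 / p)) = expR (- 2) * expR (2 - 2 / p).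
      by rewrite -expRD; congr expR; ring.
    by rewrite /l E exprMn; ring.
  by apply: cvgM; [exact: common_law_cvg | exact: (overlap_ratio_cvg dM)].
apply/cvgrPdist_le => e e0.
(* The bound of [avg_common_prob_dist] tends to its parameter eps and not to 0, so eps = [d] is
   fixed before n. *)
pose d := e / 3; have d0 : 0 < d by rewrite divr_gt0.
pose c := 1 + d^-1; have c0 : 0 < c by rewrite addr_gt0 ?invr_gt0.
near=> n.
have KM : ((K n).*2 < M n)%N by near: n; exact: (near_double_lt dM).
have n0 : (0 < n)%N by near: n; exact: nbhs_infty_gt.
have h1 : `|l - common_law n R m * overlap_ratio R n (M n) m| <= d.
  by near: n; move/cvgrPdist_le: main; apply.
have h2 : `|1 - \sum_(j < n) common_law n R j * overlap_ratio R n (M n) j| <=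
  d / c.
  by near: n; move/cvgrPdist_le: (sum_overlap_cvg dM); apply; rewrite divr_gt0.
have h3 : (n.-1 <= M n <= #|edge n|)%N by rewrite MN andbT; lia.
have := avg_common_prob_dist n0 m h3 d0; rewrite -/c => h4.
have h5 : c * (\sum_(j < n) common_law n R j * overlap_ratio R n (M n) j - 1)
  <= d.
  rewrite mulrC -ler_pdivlMr //; apply: le_trans h2.
  by rewrite distrC ler_norm.
have := ler_distD (common_law n R m * overlap_ratio R n (M n) m) l
  (avg (M n) (@common_prob R n m)).
rewrite [X in _ <= _ + X]distrC.
have : 3 * d = e by rewrite /d; field.
lra.
Unshelve. all: by end_near. Qed.

End EdgeDensity.

(** * From a fixed number of edges to G(n,p) *)

Section Mixture.
Variables (R : realType) (p : R) (n : nat).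
Implicit Types G : graph n.
Local Notation N := #|edge n|.

Lemma gnpE G : gnp p G = p ^+ #|G| * (1 - p) ^+ (N - #|G|).
Proof.
rewrite /gnp (bigID (mem G)) /=; congr (_ * _).
  rewrite -prodr_const; apply: eq_bigr => e eG.
  by rewrite eG.
have <- : #|~: G| = (N - #|G|)%N by rewrite cardsCs finset.setCK.
rewrite -prodr_const; apply: eq_big => e; first by rewrite inE.
by move/negbTE ->.
Qed.

Lemma Prob_common m : @Prob R n p (fun w => common_edges w == m) =
  \sum_G gnp p G * @common_prob R n m G.
Proof.
transitivity (\sum_G \sum_T1 \sum_T2
    law p (G, T1, T2) * (@common_edges n (G, T1, T2) == m)%:R).
  rewrite pair_bigA pair_bigA /Prob big_mkcond;
    apply: eq_bigr => -[[G T1] T2] _ /=.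
  by case: ifP; rewrite ?mulr1 ?mulr0.
apply: eq_bigr => G _; rewrite mulr_sumr; apply: eq_bigr => T1 _.
by rewrite mulr_sumr; apply: eq_bigr => T2 _; rewrite /law !mulrA.
Qed.

(** By independence the sum factorises over the edges, and the factor at e is p (1 - p) + (1 - p) (-
    p) = 0. *)
Lemma gnp_covariance (e f : edge n) : e != f ->
  \sum_G gnp p G * (((e \in G)%:R - p) * ((f \in G)%:R - p)) = 0.
Proof.
move=> ef.
pose F (g : edge n) (b : bool) : R := (if b then p else 1 - p) *
  ((if g == e then b%:R - p else 1) * (if g == f then b%:R - p else 1)).
transitivity (\prod_g (F g true + F g false)).
  rewrite bigA_distr; apply: eq_big => G; first by rewrite inE.
  move=> _; rewrite /gnp.
  have E (h : edge n) : (h \in G)%:R - p =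
    \prod_(g | g == h) ((g \in G)%:R - p) :> R.
    by rewrite big_pred1_eq.
  rewrite (E e) (E f) [X in X * _]big_mkcond [X in _ * (X * _)]big_mkcond.
  rewrite [X in _ * (_ * X)]big_mkcond -!big_split; apply: eq_bigr => g _ /=.
  by rewrite /F; case: (g \in G).
have Fe : F e true + F e false = 0.
  by rewrite /F eqxx (negbTE ef) /= !mulr1 sub0r; ring.
by rewrite (bigD1 e) //= Fe mul0r.
Qed.

Lemma gnp_variance_le : 0 <= p <= 1 ->
  \sum_(G : graph n) gnp p G * (#|G|%:R - p * N%:R) ^+ 2 <= N%:R.
Proof.
move=> p01.
have E G : #|G|%:R - p * N%:R = \sum_e ((e \in G)%:R - p) :> R.
  rewrite sumrB sumr_const mulr_natr -natr_sum; congr (_%:R - _).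
  by rewrite -sum1_card big_mkcond; apply: eq_bigr => e _; case: (e \in G).
under eq_bigr => G _ do rewrite E expr2 big_distrlr /= mulr_sumr.
rewrite exchange_big /= -[leRHS]sumr_const; apply: ler_sum => e _.
under eq_bigr => G _ do rewrite mulr_sumr.
rewrite exchange_big /= (bigD1 e) //= [X in _ + X]big1 => [|f fe]; last first.
  by rewrite gnp_covariance // eq_sym.
rewrite addr0 -[leRHS](sum_gnp n p); apply: ler_sum => G _.
rewrite ler_piMr ?gnp_ge0 //; case/andP: p01 => p0 p1.
by case: (e \in G) => /=; nra.
Qed.

(** Chebyshev's inequality with variance at most N <= n^2. *)
Lemma gnp_tail : 0 <= p <= 1 -> (0 < n)%N ->
  \sum_(G : graph n | ~~ ((#|G|%:R - p * N%:R) ^+ 2 <= n%:R ^+ 3)) gnp p G <=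
    n%:R^-1.
Proof.
move=> p01 n0.
have n0' : 0 < n%:R :> R by rewrite ltr0n.
have n3 : 0 < n%:R ^+ 3 :> R by rewrite exprn_gt0.
apply: (@le_trans _ _ (N%:R / n%:R ^+ 3)); last first.
  rewrite ler_pdivrMr // (_ : n%:R^-1 * n%:R ^+ 3 = n%:R ^+ 2); last first.
    by field; rewrite gt_eqF.
  rewrite -natrX ler_nat card_edge bin2 -mulnn.
  rewrite (leq_trans (half_leq (leq_mul (leqnn n) (leq_pred n)))) //.
  by rewrite -divn2 leq_div.
rewrite ler_pdivlMr // mulr_suml; apply: le_trans (gnp_variance_le p01).
rewrite big_mkcond; apply: ler_sum => G _; case: ifP.
  rewrite -ltNge => /ltW h; by rewrite ler_wpM2l ?gnp_ge0.
by move=> _; rewrite mulr_ge0 ?gnp_ge0 ?sqr_ge0.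
Qed.

(** [gnp] depends only on the number of edges, so G is uniform once this number is given. *)
Lemma gnp_layer m l i : (i <= N)%N ->
  \sum_(G : graph n | #|G| == i) gnp p G * (@common_prob R n m G - l) =
  (\sum_(G : graph n | #|G| == i) gnp p G) * (avg i (@common_prob R n m) - l).
Proof.
move=> iN; pose c := p ^+ i * (1 - p) ^+ (N - i).
have C0 : 'C(N, i)%:R != 0 :> R by rewrite pnatr_eq0 -lt0n bin_gt0.
have sumc (x : R) : \sum_(G : graph n | #|G| == i) x = 'C(N, i)%:R * x.
  by rewrite -card_draws -sum1dep_card natr_sum mulr_suml;
    apply: eq_bigr => G _; rewrite mul1r.
rewrite (eq_bigr (fun G => c * (@common_prob R n m G - l))) => [|G /eqP Gi];
  last first.
  by rewrite gnpE Gi.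
rewrite [X in _ = X * _](eq_bigr (fun=> c)) => [|G /eqP Gi];
  last by rewrite gnpE Gi.
rewrite -mulr_sumr sumrB !sumc /avg; set S := \sum_(G | _) _.
by field.
Qed.

End Mixture.

(** * The window of typical edge numbers *)

Section Final.
Variables (R : realType) (p l : R) (m : nat).
Hypothesis p_gt0 : 0 < p.
Hypothesis p_le1 : p <= 1.

(* The window has relative width of order n^(-1/2), which tends to 0, while the
   standard deviation of M is only of order n.  Taking for each n the worst M of
   the window makes convergence along sequences enough. *)
Let dist n i : R := `|avg i (@common_prob R n m) - l|.
Let window n i : bool := (i%:R - p * #|edge n|%:R) ^+ 2 <= n%:R ^+ 3 :> R.

(** The integer part of p N lies in the window, whose half-width is at least 1 for n > 0; for n = 0
    both N and the width are 0. So [dist] is maximised over a finite nonempty set. *)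
Lemma window_worst n : exists i, [/\ (i <= #|edge n|)%N, window n i &
  forall j, (j <= #|edge n|)%N -> window n j -> dist n j <= dist n i].
Proof.
set N := #|edge n|.
have pN0 : 0 <= p * N%:R by rewrite mulr_ge0 // ltW.
pose i0 := Num.truncn (p * N%:R).
have /andP[lo hi] := truncn_itv pN0; rewrite -/i0 in lo hi.
have i0N : (i0 < N.+1)%N.
  by rewrite ltnS -(ler_nat R) (le_trans lo) // ler_piMl.
have w0 : window n i0.
  rewrite /window -/N; case: (posnP n) => [n0|n0].
    have N0 : N = 0%N by rewrite /N card_edge n0.
    have -> : i0 = 0%N by rewrite /i0 N0 mulr0 truncn0.
    by rewrite N0 mulr0 subr0 expr0n exprn_ge0.
  apply: (@le_trans _ _ 1); last by rewrite exprn_ege1 // ler1n.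
  rewrite -[leRHS](expr1n _ 2) -[leLHS]real_normK ?num_real //.
  rewrite lerXn2r ?nnegrE // distrC ger0_norm ?subr_ge0 //.
  by rewrite lerBlDl; rewrite -natr1 in hi; exact: ltW.
case: (@arg_maxP _ _ _ (Ordinal i0N) (fun i => window n i) (fun i =>
  dist n i) w0) => i wi imax.
exists i; split => //; first by rewrite -ltnS.
by move=> j jN; apply: (imax (Ordinal (jN : (j < N.+1)%N))).
Qed.

(** For n > 1, n^2 <= 4 N, hence the squared error, at most n^3 / N^2, is at most 16 / n. *)
Lemma window_density (M : nat -> nat) : (forall n, window n (M n)) ->
  (fun n => (M n)%:R / #|edge n|%:R) @ \oo --> p.
Proof.
clear p_gt0 p_le1 => wM; apply/cvgrPdist_le => e e0.
have inv_small : \forall n \near \oo, n%:R^-1 <= 16^-1 * e ^+ 2.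
  by apply: (cvgr_le _ (@cvg_natrV R)); rewrite mulr_gt0 ?invr_gt0 ?exprn_gt0.
near=> n.
have n1 : (1 < n)%N by near: n; exact: nbhs_infty_gt.
have n0 : 0 < n%:R :> R by rewrite ltr0n; lia.
have e2 : 16 * n%:R^-1 <= e ^+ 2.
  by rewrite -ler_pdivlMl //; near: n.
have EN : (n%:R ^+ 2 <= 4 * #|edge n|%:R :> R).
  rewrite edge_natr //; have : n%:R =
    n.-1%:R + 1 :> R by rewrite natr1 prednK //; lia.
  have : 1 <= n.-1%:R :> R by rewrite ler1n; lia.
  by move=> ? ->; nra.
have N0 : 0 < #|edge n|%:R :> R.
  by have : 0 < n%:R ^+ 2 :> R by [rewrite exprn_gt0]; lra.
rewrite -(ler_pXn2r (n := 2)) ?nnegrE //; last exact: ltW.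
rewrite real_normK ?num_real // (le_trans _ e2) //.
have -> : (p - (M n)%:R / #|edge n|%:R) ^+ 2 =
    ((M n)%:R - p * #|edge n|%:R) ^+ 2 / #|edge n|%:R ^+ 2.
  by field; rewrite gt_eqF.
rewrite ler_pdivrMr ?exprn_gt0 // (le_trans (wM n)) //.
rewrite mulrAC ler_pdivlMr // -exprSr.
have -> : n%:R ^+ 4 = (n%:R ^+ 2) ^+ 2 :> R by rewrite -exprM.
have -> : 16 * #|edge n|%:R ^+ 2 = (4 * #|edge n|%:R) ^+ 2 :> R by ring.
by rewrite lerXn2r ?nnegrE // ?mulr_ge0 // exprn_ge0.
Unshelve. all: by end_near. Qed.

(** Inside the window each layer of graphs with j edges is off by at most [dist n i]; outside, the
    probability is at most 1 / n and the difference at most 1 + |l|. *)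
Lemma Prob_dist_le n i : (0 < n)%N ->
  (forall j, (j <= #|edge n|)%N -> window n j -> dist n j <= dist n i) ->
  `|@Prob R n p (fun w => common_edges w == m) - l| <=
    dist n i + (1 + `|l|) * n%:R^-1.
Proof.
move=> n0 imax; have p01 : 0 <= p <= 1 by rewrite p_le1 ltW.
set pi := @common_prob R n m.
have -> : @Prob R n p (fun w => common_edges w == m) - l =
    \sum_(G : graph n) gnp p G * (pi G - l).
  rewrite Prob_common -{1}[l]mul1r -(sum_gnp n p) mulr_suml -sumrB.
  by apply: eq_bigr => G _; rewrite mulrBr.
rewrite (bigID (fun G : graph n => window n #|G|)) /=.
apply: le_trans (ler_normD _ _) _; apply: lerD.
  rewrite (partition_big (fun G : graph n =>
    inord #|G| : 'I_#|edge n|.+1) xpredT) //=.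
  apply: le_trans (ler_norm_sum _ _ _) _.
  apply: (@le_trans _ _ (\sum_(j < #|edge n|.+1)
      (\sum_(G : graph n | #|G| == j) gnp p G) * dist n i)).
    apply: ler_sum => j _.
    have cardE (G : graph n) : (inord #|G| == j) = (#|G| == j).
      by rewrite -val_eqE /= inordK // ltnS max_card.
    under eq_bigl => G do rewrite cardE.
    have s0 : 0 <= \sum_(G : graph n | #|G| == j) gnp p G.
      by apply: sumr_ge0 => G _; rewrite gnp_ge0.
    have jN : (j <= #|edge n|)%N by rewrite -ltnS.
    (* The window depends on j alone, so a layer counts entirely or not at all. *)
    case: (boolP (window n j)) => wj; last first.
      rewrite big_pred0 => [|G]; first by rewrite normr0;
        apply: mulr_ge0 s0 (normr_ge0 _).
      by case: eqP => [->|_]; rewrite ?(negbTE wj) ?andbF.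
    rewrite (eq_bigl (fun G : graph n => #|G| == j)) => [|G]; last first.
      by case: eqP => [->|_]; rewrite ?wj ?andbF.
    by rewrite gnp_layer // normrM ger0_norm // ler_wpM2l // imax.
  rewrite -mulr_suml; apply: ler_piMl; first exact: normr_ge0.
  rewrite -(sum_gnp n p) (partition_big (fun G : graph n =>
    inord #|G| : 'I_#|edge n|.+1) xpredT) //=.
  rewrite le_eqVlt; apply/orP; left; apply/eqP; apply: eq_bigr => j _.
  by apply: eq_bigl => G; rewrite -val_eqE /= inordK // ltnS max_card.
apply: le_trans (ler_norm_sum _ _ _) _.
apply: (@le_trans _ _
  (\sum_(G : graph n | ~~ window n #|G|) gnp p G * (1 + `|l|))).
  apply: ler_sum => G _; rewrite normrM ger0_norm ?gnp_ge0 //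
    ler_wpM2l ?gnp_ge0 //.
  rewrite (le_trans (ler_normB _ _)) // lerD2r ger0_norm ?common_prob_ge0 //.
  exact: common_prob_le1.
by rewrite -mulr_suml mulrC ler_wpM2l ?addr_ge0 // gnp_tail.
Qed.

End Final.

Theorem theorem2p4 (R : realType) (p : R) (hp0 : 0 < p) (hp1 : p <= 1)
    (m : nat) :
  (fun n : nat => @Prob R n p (fun w : outcome n => common_edges w == m))
    @ \oo --> expR (- (2 / p)) * ((2 / p) ^+ m / (m`!)%:R).
Proof.
set l := (X in _ --> X).
(* The worst edge numbers form a sequence of density p, so the limit along it controls the whole
   window. *)
have /choice[M HM] := window_worst l m hp0 hp1.
have dM : edge_density p M.
  split => //; first by move=> n; have [] := HM n.
  by apply: window_density => n; have [] := HM n.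
have lim := avg_common_prob_cvg (m := m) dM.
apply/cvgrPdist_le => e e0.
have d0 : 0 < e / 2 by rewrite divr_gt0.
have l0 : 0 < 1 + `|l| by rewrite ltr_pwDl.
near=> n.
have n0 : (0 < n)%N by near: n; exact: nbhs_infty_gt.
have h1 : `|l - avg (M n) (@common_prob R n m)| <= e / 2.
  by near: n; move/cvgrPdist_le: lim; apply.
have h2 : (1 + `|l|) * n%:R^-1 <= e / 2.
  rewrite -ler_pdivlMl //; near: n.
  by apply: (cvgr_le _ (@cvg_natrV R)); rewrite mulr_gt0 ?invr_gt0.
have [_ _ imax] := HM n; have := Prob_dist_le hp0 hp1 n0 imax.
by rewrite distrC in h1; rewrite distrC; lra.
Unshelve. all: by end_near. Qed.
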